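(* Let $H$ be a connected triangle-free graph with no full star-cutset, and let $H^*$ be a subdivision of $H$. Then $H^*$ is a restricted frame graph if and only if $H$ is either a path on at most $4$ vertices or a luxury chandelier.
   Context: A frame is the boundary of an axis-parallel box $I\times J\subset\mathbb R^2$ ($I,J$ intervals). A graph $G$ is a restricted frame graph if there is a family of frames $\{F_v : v\in V(G)\}$ with $uv\in E(G)$ iff $F_u\cap F_v\neq\emptyset$, satisfying: (1) corners of a frame do not coincide with any point of another frame; (2) the left side of any frame does not intersect any other frame; (3) if the right side of a frame intersects a second frame, this right side intersects both the top and the bottom side of the second frame; (4) if two frames have non-empty intersection, then no frame is entirely contained in the intersection of the two closed regions bounded by these two frames. A full star-cutset of a connected graph $G$ is a set $N[u]=\{u\}\cup N(u)$ whose removal disconnects $G$. A chandelier is a graph obtained from a tree $T$ by adding a new vertex (the pivot) adjacent to every leaf of $T$; it is a luxury chandelier if in $T$ the neighbor of each leaf has degree two. A subdivision of a graph is obtained by replacing edges by paths (each edge by a path with at least one edge). *)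

(* Defs.v *)
From mathcomp Require Import all_boot.
From Stdlib Require Import Reals.
Set Implicit Arguments. Unset Strict Implicit. Unset Printing Implicit Defensive.

Record sgraph := SGraph {
  vert : finType;
  adj : rel vert;
  adj_sym : symmetric adj;
  adj_irr : irreflexive adj }.

Definition connected_graph (G : sgraph) : Prop :=
  (0 < #|vert G|)%N /\ forall x y : vert G, connect (@adj G) x y.

Definition triangle_free (G : sgraph) : Prop :=
  forall x y z : vert G, ~ [&& adj x y, adj y z & adj x z].

Definition closed_nbhd (G : sgraph) (u : vert G) : {set vert G} :=
  u |: [set w | adj u w].

Definition adj_out (G : sgraph) (A : {set vert G}) : rel (vert G) :=
  fun x y => [&& adj x y, x \notin A & y \notin A].

Definition full_star_cutset (G : sgraph) (u : vert G) : Prop :=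
  exists x y : vert G, [/\ x \notin closed_nbhd u, y \notin closed_nbhd u &
                         ~~ connect (adj_out (closed_nbhd u)) x y].

Definition no_full_star_cutset (G : sgraph) : Prop :=
  forall u : vert G, ~ full_star_cutset u.

Definition is_path_graph (G : sgraph) (n : nat) : Prop :=
  exists g : vert G -> 'I_n, bijective g /\
    forall u v : vert G, adj u v = ((g u).+1 == g v) || ((g v).+1 == g u).

Definition path_at_most4 (G : sgraph) : Prop :=
  exists n, (1 <= n <= 4)%N /\ is_path_graph G n.

Definition adj_in (G : sgraph) (A : {set vert G}) : rel (vert G) :=
  fun x y => [&& adj x y, x \in A & y \in A].

Definition tree_on (G : sgraph) (A : {set vert G}) : Prop :=
  [/\ A != set0,
      (forall x y, x \in A -> y \in A -> connect (adj_in A) x y) &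
      (forall c : seq (vert G), all (mem A) c -> uniq c -> (3 <= size c)%N ->
          ~~ cycle (adj_in A) c)].

Definition deg_in (G : sgraph) (A : {set vert G}) (v : vert G) : nat :=
  #|[set w in A | adj v w]|.

Definition luxury_chandelier (G : sgraph) : Prop :=
  exists p : vert G,
    let A := [set~ p] in
    [/\ tree_on A,
        (forall v, v != p -> adj p v = (deg_in A v == 1%N)) &
        (forall v w, v != p -> w != p -> deg_in A v = 1%N -> adj v w ->
            deg_in A w = 2%N)].

(* Hs is a subdivision of H: branch vertices f u, and for every edge uv of H
   a path f u, P u v, f v in Hs (P u v = internal vertices, possibly empty);
   the internal vertex sets are pairwise disjoint and avoid branch vertices,
   every vertex of Hs is a branch or internal vertex, and the edges of Hs are
   exactly the consecutive pairs of these paths. *)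
Definition subdivision_of (Hs H : sgraph) : Prop :=
  exists (f : vert H -> vert Hs) (P : vert H -> vert H -> seq (vert Hs)),
  [/\ injective f /\ (forall u v, adj u v -> P v u = rev (P u v)),
      (forall u v, adj u v -> uniq (P u v) /\
                  forall w, w \in P u v -> w \notin codom f),
      (forall u v u' v', adj u v -> adj u' v' ->
          ~~ (((u == u') && (v == v')) || ((u == v') && (v == u'))) ->
          all (fun w => w \notin P u' v') (P u v)),
      (forall w, w \in codom f \/ exists u v, adj u v /\ w \in P u v) &
      (forall x y, adj x y <->
          exists u v, adj u v /\ infix [:: x; y] (f u :: rcons (P u v) (f v)))].

(* the frame = boundary of [fa,fb] x [fc,fd], with fa < fb and fc < fd *)
Record frame := Frame {
  fa : R; fb : R; fc : R; fd : R;
  fab : Rlt fa fb; fcd : Rlt fc fd }.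

Definition between (lo x hi : R) : Prop := Rle lo x /\ Rle x hi.

Definition left_side (F : frame) (p : R * R) : Prop :=
  p.1 = fa F /\ between (fc F) p.2 (fd F).
Definition right_side (F : frame) (p : R * R) : Prop :=
  p.1 = fb F /\ between (fc F) p.2 (fd F).
Definition bottom_side (F : frame) (p : R * R) : Prop :=
  p.2 = fc F /\ between (fa F) p.1 (fb F).
Definition top_side (F : frame) (p : R * R) : Prop :=
  p.2 = fd F /\ between (fa F) p.1 (fb F).

Definition on_frame (F : frame) (p : R * R) : Prop :=
  left_side F p \/ right_side F p \/ bottom_side F p \/ top_side F p.

Definition corner (F : frame) (p : R * R) : Prop :=
  (p.1 = fa F \/ p.1 = fb F) /\ (p.2 = fc F \/ p.2 = fd F).

Definition in_box (F : frame) (p : R * R) : Prop :=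
  between (fa F) p.1 (fb F) /\ between (fc F) p.2 (fd F).

Definition frames_meet (F F' : frame) : Prop :=
  exists p, on_frame F p /\ on_frame F' p.

Definition restricted_frame_graph (G : sgraph) : Prop :=
  exists Fr : vert G -> frame,
  [/\ (forall u v, u <> v -> (adj u v <-> frames_meet (Fr u) (Fr v))),
      (forall u v, u <> v -> forall p, corner (Fr u) p -> ~ on_frame (Fr v) p),
      (forall u v, u <> v -> forall p, left_side (Fr u) p -> ~ on_frame (Fr v) p),
      (forall u v, u <> v ->
         (exists p, right_side (Fr u) p /\ on_frame (Fr v) p) ->
         (exists p, right_side (Fr u) p /\ top_side (Fr v) p) /\
         (exists p, right_side (Fr u) p /\ bottom_side (Fr v) p)) &
      (forall u v, u <> v -> frames_meet (Fr u) (Fr v) ->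
         forall w, ~ (forall p, on_frame (Fr w) p -> in_box (Fr u) p /\ in_box (Fr v) p))].

(* Main.v *)
Require Import Defs.
From mathcomp Require Import all_boot.
From Stdlib Require Import Reals Lra Classical.
From mathcomp Require Import zify.
Set Implicit Arguments. Unset Strict Implicit. Unset Printing Implicit Defensive.

(** In a restricted frame representation, two adjacent frames cross in only one
    way: one of them enters the other through its right side. Two non-adjacent
    frames are nested or have disjoint boxes. Two frames entered by a third one
    share a point, so in a triangle-free graph they are nested. If there is no
    full star-cutset, all non-neighbours of a frame lie on the same side of it,
    so the frames that contain another one are pairwise adjacent; hence there
    are at most two of them, and after deleting the leftmost, [p], every frame
    enters at most one other, so the rest is a forest.

    When [H] has minimum degree at least 2, subdividing preserves the absence of
    triangles and of full star-cutsets, so this applies to [H*]; the vertex [p]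
    pulls back to a vertex of [H] meeting all cycles, and the absence of full
    star-cutsets in [H] then forces a luxury chandelier. A vertex of degree at
    most 1 forces a path on at most 4 vertices.

    Conversely, [H*] has a vertex [p] such that [H* - p] is a forest in which
    the neighbours of [p] have degree at most 1. Root every component so that these
    neighbours have no children, draw the forest from left to right inside a
    large frame for [p], and let the neighbours of [p] stick out on the right. *)

(** * Relative position of two frames *)

Section FramePositions.
Local Open Scope R_scope.

(* [G] enters [F] through its right side. *)
Definition crosses (F G : frame) : Prop :=
  (fa F < fa G /\ fa G < fb F /\ fb F < fb G) /\ (fc F < fc G /\ fd G < fd F).

Definition inside (F G : frame) : Prop :=
  (fa G < fa F /\ fb F < fb G) /\ (fc G < fc F /\ fd F < fd G).

Definition separated (F G : frame) : Prop :=
  fb F < fa G \/ fb G < fa F \/ fd F < fc G \/ fd G < fc F.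

Lemma crosses_meet F G : crosses F G -> frames_meet F G.
Proof.
move=> [[h1 [h2 h3]] [h4 h5]]; have hF := fcd F; have hG := fcd G.
exists (fb F, fc G); split; [right; left | right; right; left].
  by split=> //=; split=> /=; lra.
by split=> //=; split=> /=; lra.
Qed.

Lemma frames_meet_sym F G : frames_meet F G -> frames_meet G F.
Proof. by case=> p [h1 h2]; exists p. Qed.

Lemma inside_not_meet F G : inside F G -> ~ frames_meet F G.
Proof.
move=> [[h1 h2] [h3 h4]] [[x y] []]; rewrite /on_frame /left_side /right_side
  /top_side /bottom_side /between /=.
have := fab F; have := fcd F; have := fab G; have := fcd G.
by move=> *; lra.
Qed.

Lemma separated_sym F G : separated F G -> separated G F.
Proof. by rewrite /separated; tauto. Qed.

Lemma separated_not_meet F G : separated F G -> ~ frames_meet F G.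
Proof.
move=> h [[x y] []]; move: h; rewrite /separated /on_frame /left_side /right_side
  /top_side /bottom_side /between /=.
have := fab F; have := fcd F; have := fab G; have := fcd G.
by move=> *; lra.
Qed.

(** This predicate and the next two are conditions (1), (2) and (3) on restricted frames, each for
    one ordered pair. *)
Definition corners_free F G := forall p, corner F p -> ~ on_frame G p.
Definition left_free F G := forall p, left_side F p -> ~ on_frame G p.
Definition right_through F G :=
  (exists p, right_side F p /\ on_frame G p) ->
  (exists p, right_side F p /\ top_side G p) /\
  (exists p, right_side F p /\ bottom_side G p).

Lemma not_meet_free F G : ~ frames_meet F G ->
  [/\ corners_free F G, left_free F G & right_through F G].
Proof.
move=> nm; split.
- move=> [x y] [/= hx hy] hG; apply: nm; exists (x, y); split=> //.
  have := fab F; have := fcd F; rewrite /on_frame /left_side /right_side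
    /top_side /bottom_side /between /=.
  by move=> *; case: hx => ->; case: hy => ->; lra.
- by move=> p hF hG; apply: nm; exists p; split=> //; left.
- by case=> p [hF hG]; case: nm; exists p; split=> //; right; left.
Qed.

Lemma crosses_free F G : crosses F G ->
  [/\ corners_free F G, left_free F G & right_through F G] /\
  [/\ corners_free G F, left_free G F & right_through G F].
Proof.
move=> [[h1 [h2 h3]] [h4 h5]]; have hF := fcd F; have hG := fcd G.
rewrite /corners_free /left_free /right_through /corner.
rewrite /on_frame /left_side /right_side /top_side /bottom_side /between.
split; split.
- by move=> [x y] /=; lra.
- by move=> [x y] /=; lra.
- by move=> _; split; [exists (fb F, fd G)|exists (fb F, fc G)] => /=; lra.
- by move=> [x y] /=; lra.
- by move=> [x y] /=; lra.
- by case=> -[x y] /=; lra.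
Qed.

(** Condition (3) puts points of the right side of [F] on the top and bottom of [G]. Free corners
    make the resulting inequalities strict, and [fa G <= fa F] would put a point of the left side of
    [F] on the top of [G]. *)
Lemma right_side_crosses F G : corners_free F G -> corners_free G F ->
  left_free F G -> right_through F G ->
  (exists p, right_side F p /\ on_frame G p) -> crosses F G.
Proof.
move=> cFG cGF lF rF /rF [[[x1 y1]] []]; rewrite /right_side /top_side /between /=.
move=> [-> hy1] [e1 hx1] [[x2 y2]] []; rewrite /bottom_side /between /=.
move=> [-> hy2] [e2 hx2]; subst y1 y2.
have abF := fab F; have cdF := fcd F; have abG := fab G; have cdG := fcd G.
have n1 : fb F <> fa G.
  move=> e; apply: (cGF (fa G, fd G)); first by split; [left|right].
  by right; left; rewrite /right_side /between /=; lra.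
have n2 : fb F <> fb G.
  move=> e; apply: (cGF (fb G, fd G)); first by split; right.
  by right; left; rewrite /right_side /between /=; lra.
have n3 : fd G <> fd F.
  move=> e; apply: (cFG (fb F, fd F)); first by split; right.
  by do 3!right; rewrite /top_side /between /=; lra.
have n4 : fc G <> fc F.
  move=> e; apply: (cFG (fb F, fc F)); first by split; [right|left].
  by do 2!right; left; rewrite /bottom_side /between /=; lra.
suff n5 : fa F < fa G by rewrite /crosses; lra.
apply: Rnot_le_lt => le_a; apply: (lF (fa F, fd G)).
  by rewrite /left_side /between /=; lra.
by do 3!right; rewrite /top_side /between /=; lra.
Qed.

Lemma meet_crosses F G : corners_free F G -> corners_free G F ->
  left_free F G -> left_free G F -> right_through F G -> right_through G F ->
  frames_meet F G -> crosses F G \/ crosses G F.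
Proof.
move=> cFG cGF lF lG rF rG [p [hF hG]].
case: (hF) => [h|]; first by case: (lF p).
case=> [h|hF2]; first by left; apply: right_side_crosses => //; exists p.
case: (hG) => [h|]; first by case: (lG p).
case=> [h|hG2]; first by right; apply: right_side_crosses => //; exists p.
(* Overlapping horizontal sides contain a corner. *)
exfalso; have [le_a|lt_a] := Rle_lt_dec (fa F) (fa G).
- apply: (cGF (fa G, p.2)).
    by case: hG2 => -[-> _]; split=> /=; auto.
  by case: hF2 => -[-> hx]; [do 2!right; left|do 3!right];
    case: hG2 => -[_ hx']; split=> //=; rewrite /between /= in hx hx' *; lra.
- apply: (cFG (fa F, p.2)).
    by case: hF2 => -[-> _]; split=> /=; auto.
  by case: hG2 => -[-> hx]; [do 2!right; left|do 3!right];
    case: hF2 => -[_ hx']; split=> //=; rewrite /between /= in hx hx' *; lra.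
Qed.

(** Otherwise [(x, y)] would lie both on a vertical side of [F] and on a horizontal side of [G]. *)
Lemma not_meet_side F G x y : ~ frames_meet F G ->
  (x = fa F \/ x = fb F) -> (y = fc G \/ y = fd G) ->
  ~ (fa G <= x <= fb G /\ fc F <= y <= fd F).
Proof.
move=> nm hx hy [h1 h2]; apply: nm; exists (x, y).
rewrite /on_frame /left_side /right_side /top_side /bottom_side /between /=.
by lra.
Qed.

Lemma not_meet_cases F G : ~ frames_meet F G ->
  [\/ inside F G, inside G F | separated F G].
Proof.
move=> nm; have abF := fab F; have cdF := fcd F; have abG := fab G; have cdG := fcd G.
have nm' : ~ frames_meet G F by move/frames_meet_sym.
(* No vertical side of one frame crosses a horizontal side of the other: these are the eight choices
   of such a pair. When the boxes overlap, comparing the left ends decides which frame is nested in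
   the other. *)
have n1 := @not_meet_side _ _ (fa F) (fc G) nm (or_introl erefl) (or_introl erefl).
have n2 := @not_meet_side _ _ (fa F) (fd G) nm (or_introl erefl) (or_intror erefl).
have n3 := @not_meet_side _ _ (fb F) (fc G) nm (or_intror erefl) (or_introl erefl).
have n4 := @not_meet_side _ _ (fb F) (fd G) nm (or_intror erefl) (or_intror erefl).
have n5 := @not_meet_side _ _ (fa G) (fc F) nm' (or_introl erefl) (or_introl erefl).
have n6 := @not_meet_side _ _ (fa G) (fd F) nm' (or_introl erefl) (or_intror erefl).
have n7 := @not_meet_side _ _ (fb G) (fc F) nm' (or_intror erefl) (or_introl erefl).
have n8 := @not_meet_side _ _ (fb G) (fd F) nm' (or_intror erefl) (or_intror erefl).
case: (classic (separated F G)) => [s|ns]; first by constructor 3.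
have [[s1 s2] [s3 s4]] : (fa G <= fb F /\ fa F <= fb G) /\
    (fc G <= fd F /\ fc F <= fd G) by rewrite /separated in ns; lra.
case: (Rlt_le_dec (fa G) (fa F)) => h; [constructor 1|constructor 2];
  rewrite /inside; clear ns nm nm'.
- have h3 : fc G < fc F by case: (Rlt_le_dec (fc G) (fc F)) => // ?; lra.
  have h4 : fd F < fd G by case: (Rlt_le_dec (fd F) (fd G)) => // ?; lra.
  have h2 : fb F < fb G by case: (Rlt_le_dec (fb F) (fb G)) => // ?; lra.
  by [].
- case: (Rlt_le_dec (fc F) (fc G)) => h3; last lra.
  case: (Rlt_le_dec (fd G) (fd F)) => h4; last lra.
  case: (Rlt_le_dec (fb G) (fb F)) => h2; last lra.
  case: (Rlt_le_dec (fa F) (fa G)) => // ?; lra.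
Qed.

End FramePositions.

(** * From a layout of frames to a restricted frame graph *)

Lemma adj_neq (G : sgraph) (x y : vert G) : adj x y -> x != y.
Proof. by apply: contraTneq => ->; rewrite adj_irr. Qed.

Lemma in_closed_nbhd (G : sgraph) (u x : vert G) :
  (x \in closed_nbhd u) = (x == u) || adj u x.
Proof. by rewrite !inE. Qed.

(** Conditions (1) to (3) are checked pair by pair. For (4), a frame in the boxes of two adjacent
    frames is neither of them, since crossing boxes are not nested; only [p] may contain another
    frame, so both would be [p]. *)
Lemma restricted_frame_graph_of_layout (G : sgraph) (p : vert G)
    (Fr : vert G -> frame) :
  (forall u v, adj u v -> crosses (Fr u) (Fr v) \/ crosses (Fr v) (Fr u)) ->
  (forall u v, u != v -> ~~ adj u v ->
     [\/ v = p /\ inside (Fr u) (Fr v), u = p /\ inside (Fr v) (Fr u)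
       | separated (Fr u) (Fr v)]) ->
  restricted_frame_graph G.
Proof.
move=> hadj hnadj; exists Fr.
have nadj_nmeet u v : u != v -> ~~ adj u v -> ~ frames_meet (Fr u) (Fr v).
  move=> uv /(hnadj _ _ uv) [[_ i]|[_ i]|s].
  - exact: inside_not_meet i.
  - by move/frames_meet_sym; apply: inside_not_meet i.
  - exact: separated_not_meet s.
have free u v : u <> v -> [/\ corners_free (Fr u) (Fr v), left_free (Fr u) (Fr v)
      & right_through (Fr u) (Fr v)].
  move=> /eqP uv; case: (boolP (adj u v)) => [/hadj|/(nadj_nmeet _ _ uv)].
    by case=> /crosses_free [].
  exact: not_meet_free.
split.
- move=> u v /eqP uv; split.
    by move/hadj=> [/crosses_meet //|/crosses_meet /frames_meet_sym].
  by move=> m; apply/negPn/negP=> /(nadj_nmeet _ _ uv).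
- by move=> u v /free [].
- by move=> u v /free [].
- by move=> u v /free [].
move=> u v /eqP uv m w w_in.
have a_uv : adj u v by apply/negPn/negP=> /(nadj_nmeet _ _ uv).
have abw := fab (Fr w); have cdw := fcd (Fr w).
(* The bottom left and top right corners of [w] already force its box into both boxes. *)
have [lo_u lo_v] := w_in (fa (Fr w), fc (Fr w))
  ltac:(left; rewrite /left_side /between /=; lra).
have [hi_u hi_v] := w_in (fb (Fr w), fd (Fr w))
  ltac:(right; left; rewrite /right_side /between /=; lra).
move: lo_u lo_v hi_u hi_v; rewrite /in_box /between /= => lo_u lo_v hi_u hi_v.
have wp t : (fa (Fr t) <= fa (Fr w) /\ fb (Fr w) <= fb (Fr t) /\
    fc (Fr t) <= fc (Fr w) /\ fd (Fr w) <= fd (Fr t))%R -> w = t \/ t = p.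
  move=> in_t; case: (eqVneq w t) => [->|wt]; [by left | right].
  case: (boolP (adj w t)) => [/hadj|/(hnadj _ _ wt)].
    by rewrite /crosses; lra.
  by case=> [[]//|[_]|]; rewrite /inside /separated; lra.
have cr := hadj _ _ a_uv; rewrite /crosses in cr.
case: (wp u ltac:(lra)) => [ew|eu]; first by subst w; lra.
case: (wp v ltac:(lra)) => [ew|ev]; first by subst w; lra.
by rewrite eu ev eqxx in uv.
Qed.

(** Says that [A] induces a forest, in a form suited to removing vertices one by one and to passing
    between a graph and its subdivisions. *)
Definition one_degenerate (G : sgraph) (A : {set vert G}) : Prop :=
  forall B : {set vert G}, B \subset A -> B != set0 ->
    exists2 w, w \in B & forall x y, x \in B -> y \in B -> adj w x -> adj w y -> x = y.

Lemma exists_maximal (T : finType) (F : T -> R) (B : {set T}) : B != set0 ->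
  exists2 w, w \in B & forall x, x \in B -> (F x <= F w)%R.
Proof.
have seq_max (s : seq T) : s != [::] ->
    exists2 w, w \in s & forall x, x \in s -> (F x <= F w)%R.
  elim: s => // a [|b s] IH _.
    by exists a; rewrite ?inE // => x; rewrite inE => /eqP ->; lra.
  have [w ws hw] := IH isT.
  case: (Rle_lt_dec (F a) (F w)) => h.
    exists w; first by rewrite inE ws orbT.
    by move=> x; rewrite inE => /predU1P [->|/hw].
  exists a; first by rewrite inE eqxx.
  by move=> x; rewrite inE => /predU1P [->|/hw]; lra.
move=> B0; have [|w] := seq_max (enum B).
  by rewrite -size_eq0 -cardE cards_eq0.
rewrite mem_enum => wB hw; exists w => // x xB; apply: hw.
by rewrite mem_enum.
Qed.

(** * The apex of a frame representation *)

Section Apex.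
Context (G : sgraph) (Fr : vert G -> frame).
Hypothesis adj_crosses :
  forall u v, adj u v -> crosses (Fr u) (Fr v) \/ crosses (Fr v) (Fr u).
Hypothesis nonadj_cases : forall u v, u != v -> ~~ adj u v ->
  [\/ inside (Fr u) (Fr v), inside (Fr v) (Fr u) | separated (Fr u) (Fr v)].
Hypothesis tfree : triangle_free G.
Hypothesis no_cut : no_full_star_cutset G.

Let inside_neq u v : inside (Fr u) (Fr v) -> u != v.
Proof. by apply: contraPneq => ->; rewrite /inside; lra. Qed.

Let inside_nonadj u v : inside (Fr u) (Fr v) -> ~~ adj u v.
Proof.
move=> i; apply/negP=> /adj_crosses; move: i; rewrite /inside /crosses.
by have := fab (Fr u); have := fab (Fr v); have := fcd (Fr u); have := fcd (Fr v); lra.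
Qed.

(* Frames avoiding the curve [Fr u] and connected to each other lie on the
   same side of it. *)
Let inside_all u r s : inside (Fr r) (Fr u) -> s != u -> ~~ adj u s ->
  inside (Fr s) (Fr u).
Proof.
move=> r_in su n_us.
have rN : r \notin closed_nbhd u.
  by rewrite in_closed_nbhd negb_or inside_neq //= adj_sym inside_nonadj.
have sN : s \notin closed_nbhd u by rewrite in_closed_nbhd negb_or su.
have : connect (adj_out (closed_nbhd u)) r s.
  by apply/negPn/negP=> nc; apply: (no_cut (u := u)); exists r, s; split.
move=> /connectP [c pc ->] {su n_us rN sN s}.
elim: c r r_in pc => //= y c IH r r_in /andP [/and3P [ry _ yN] pc].
apply: IH pc; move: yN; rewrite in_closed_nbhd negb_or => /andP [yu n_uy].
have n_yu : ~~ adj y u by rewrite adj_sym.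
case: (nonadj_cases yu n_yu) => [//|i|s];
  exfalso; have := adj_crosses ry; move: r_in; rewrite /crosses.
- by move: i; rewrite /inside; lra.
- move: s; rewrite /separated /inside.
  have := fab (Fr y); have := fcd (Fr y); have := fab (Fr u); have := fcd (Fr u).
  by have := fab (Fr r); have := fcd (Fr r); lra.
Qed.

Let big u := exists r, inside (Fr r) (Fr u).

(** Two non-adjacent frames that both contain a frame would each be inside the other. *)
Let big_adj u v : big u -> big v -> u != v -> adj u v.
Proof.
move=> [r r_in] [s s_in] uv; apply/negPn/negP=> n_uv.
have iuv : inside (Fr u) (Fr v) by apply: inside_all s_in uv _; rewrite adj_sym.
have vu : v != u by rewrite eq_sym.
have := inside_all r_in vu n_uv.
by move: iuv; rewrite /inside; lra.
Qed.

(** Both boxes contain the bottom left corner of [v], so they are not separated; adjacency of [x]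
    and [y] would give a triangle with [v]. *)
Let two_entered v x y : crosses (Fr x) (Fr v) -> crosses (Fr y) (Fr v) ->
  adj x v -> adj y v -> x != y ->
  inside (Fr x) (Fr y) \/ inside (Fr y) (Fr x).
Proof.
move=> cx cy ax ay xy; case: (@nonadj_cases x y) => // [|||s]; [|by left|by right|].
- by apply/negP=> axy; apply: (tfree (x := x) (y := y) (z := v)); rewrite axy ay ax.
- exfalso; move: s cx cy; rewrite /separated /crosses.
  have := fab (Fr x); have := fcd (Fr x); have := fab (Fr y); have := fcd (Fr y).
  by have := fab (Fr v); have := fcd (Fr v); lra.
Qed.

(** In a crossing the entering frame has the higher bottom side. Hence the frame of [B] with the
    highest bottom enters all its neighbours in [B], and there is at most one of them. *)
Lemma one_degenerate_of_one_entered p :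
  (forall v x y, v != p -> x != p -> y != p -> adj x v -> adj y v ->
     crosses (Fr x) (Fr v) -> crosses (Fr y) (Fr v) -> x = y) ->
  one_degenerate [set~ p].
Proof.
move=> uniq_in B BA /(exists_maximal (fun v => fc (Fr v))) [w wB wmax].
have np t : t \in B -> t != p by move/(subsetP BA); rewrite !inE.
have in_w x : x \in B -> adj w x -> crosses (Fr x) (Fr w).
  move=> xB /adj_crosses [|//]; rewrite /crosses; have := wmax _ xB; lra.
exists w => // x y xB yB wx wy.
have [xw yw] : adj x w /\ adj y w by rewrite adj_sym wx adj_sym wy.
by apply: (uniq_in w x y) => //; auto.
Qed.

(* The apex is a frame containing another frame, the leftmost one if there
   are two. *)
Lemma exists_apex : 0 < #|vert G| -> exists p : vert G, one_degenerate [set~ p].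
Proof.
move=> /card_gt0P [p0 _].
case: (classic (exists p, big p)) => [[p1 big1]|nobig]; last first.
  exists p0; apply: one_degenerate_of_one_entered => v x y _ _ _ ax ay cx cy.
  apply/eqP/negPn/negP=> /(two_entered cx cy ax ay) [i|i]; case: nobig.
    by exists y, x.
  by exists x, y.
have [p [r r_in] pmin] : exists2 p, big p &
    forall q, big q -> q != p -> crosses (Fr p) (Fr q).
  (* If [p1] enters some big [q], then [q] is the choice: a third big frame would form a triangle
     with [q] and [p1]. *)
  case: (classic (exists2 q, big q & q != p1 /\ crosses (Fr q) (Fr p1))).
    move=> [q bq [qp cq]]; exists q => // r br rq.
    case: (eqVneq r p1) => [->//|rp]; exfalso.
    apply: (tfree (x := r) (y := q) (z := p1)).
    by rewrite !big_adj.
  move=> nq; exists p1 => // q bq qp.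
  case: (adj_crosses (big_adj bq big1 qp)) => // c; case: nq.
  by exists q.
have bp : big p by exists r.
exists p; apply: one_degenerate_of_one_entered.
(* Suppose [v] enters a big [y] other than [p]. Since [y] enters [p], the vertex [v] is not adjacent
   to [p] and so lies inside it. But [v] reaches further right than [y], and [y] further right than
   [p]. *)
suff key v x y : v != p -> y != p -> adj y v ->
    crosses (Fr y) (Fr v) -> inside (Fr x) (Fr y) -> False.
  move=> v x y vp xp yp ax ay cx cy; apply/eqP/negPn/negP=> xy.
  by case: (two_entered cx cy ax ay xy) => i; [apply: key ay cy i|apply: key ax cx i].
move=> vp yp ay cy i.
have big_y : big y by exists x.
have cpy := pmin _ big_y yp.
have apy : adj p y by apply: big_adj; rewrite // eq_sym.
have n_pv : ~~ adj p v.
  by apply/negP=> apv; apply: (tfree (x := p) (y := y) (z := v)); rewrite apy ay apv.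
by have := inside_all r_in vp n_pv; move: cy cpy; rewrite /inside /crosses; lra.
Qed.

End Apex.

Lemma restricted_frame_graph_apex (G : sgraph) : 0 < #|vert G| ->
  triangle_free G -> no_full_star_cutset G -> restricted_frame_graph G ->
  exists p : vert G, one_degenerate [set~ p].
Proof.
move=> G0 tf nc [Fr [hadj hc hl hr _]]; apply: (@exists_apex _ Fr) => //.
- move=> u v auv; have uv : u <> v by apply/eqP/adj_neq.
  have vu : v <> u by move=> e; apply: uv.
  by apply: meet_crosses; try exact: hc; try exact: hl; try exact: hr;
    apply/hadj.
- move=> u v /eqP uv n_uv; apply: not_meet_cases => m.
  by move/negP: n_uv; apply; apply/hadj.
Qed.

(** * Acyclic graphs *)

(** On the vertex set of a cycle, a vertex with at most one neighbour would have equal successor and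
    predecessor, which is impossible for length at least 3. *)
Lemma one_degenerate_acyclic (G : sgraph) (A : {set vert G}) (c : seq (vert G)) :
  one_degenerate A -> all (mem A) c -> uniq c -> 3 <= size c ->
  ~~ cycle (adj_in A) c.
Proof.
move=> dA cA uc sc; apply/negP=> cyc.
have [w] : exists2 w, w \in [set x in c] & forall x y, x \in [set x in c] ->
    y \in [set x in c] -> adj w x -> adj w y -> x = y.
  apply: dA; first by apply/subsetP=> x; rewrite inE => /(allP cA).
  by case: c sc {cA uc cyc} => // a c _; apply/set0Pn; exists a; rewrite inE mem_head.
rewrite inE => wc w1.
have wn : adj w (next c w) by have /and3P [] := next_cycle cyc wc.
have wp : adj w (prev c w) by rewrite adj_sym; have /and3P [] := prev_cycle cyc wc.
have e : next c w = prev c w by apply: w1 => //; rewrite inE ?mem_next ?mem_prev.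
move: e wc uc sc {w1 wn wp cyc cA} => e wc uc sc.
case: (rot_to wc) => i s es.
have ur : uniq (w :: s) by rewrite -es rot_uniq.
have er : next (w :: s) w = prev (w :: s) w by rewrite -es next_rot // prev_rot.
have : 3 <= size (w :: s) by rewrite -es size_rot.
case: s ur er {es} => [|a [|b s]] // ur er _.
move: er; rewrite [LHS]/= eqxx => er.
have : next (w :: a :: b :: s) (next (w :: a :: b :: s) w) = w.
  by rewrite -[RHS](next_prev ur w) -er /= eqxx.
rewrite /= eqxx; case/and3P: ur => /norP [wa /norP [wb _]] _ _.
by rewrite eq_sym (negPf wa) eqxx => /esym e'; rewrite e' eqxx in wb.
Qed.

(** A walk from [s1] to [s2] avoiding [w], once shortened, closes up through [w] to a cycle in [A].
    The relation [r] is left general so that it can be adjacency off a closed neighbourhood. *)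
Lemma acyclic_nbrs_not_connect (G : sgraph) (A : {set vert G}) (w s1 s2 : vert G)
    (r : rel (vert G)) :
  one_degenerate A -> w \in A -> s1 != s2 -> adj w s1 -> adj w s2 ->
  (forall x y, r x y -> [&& adj x y, x \in A, y \in A, x != w & y != w]) ->
  ~~ connect r s1 s2.
Proof.
move=> dA wA s12 w1 w2 hr; apply/negP=> /connectP [c0 pc0 e0].
case: (shortenP pc0) e0 => c pc uc _ e2 {c0 pc0}.
case: c pc uc e2 => [|a c] pc uc e2; first by rewrite e2 eqxx in s12.
have hall : all (fun x => (x \in A) && (x != w)) (s1 :: a :: c).
  apply/allP=> x; rewrite inE => /predU1P [->|].
    by move: pc => /= /andP [/hr /and5P [_ -> _ -> _]].
  move: (a :: c) (s1) pc => {e2 uc}; elim=> // b d IH t /= /andP [/hr h pd].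
  rewrite inE => /predU1P [->|]; last exact: IH pd.
  by case/and5P: h => _ _ -> _ ->.
have wn : w \notin s1 :: a :: c.
  by apply/negP=> /(allP hall); rewrite eqxx andbF.
have allA : all (mem A) (w :: s1 :: a :: c).
  by apply/allP=> x; rewrite inE => /predU1P [->//|/(allP hall) /andP []].
have un : uniq (w :: s1 :: a :: c) by rewrite cons_uniq wn.
have /negP := one_degenerate_acyclic dA allA un isT; apply.
have sub : subrel r (adj_in A) by move=> x y /hr /and5P [xy xA yA _ _]; apply/and3P.
have inA x : x \in w :: s1 :: a :: c -> x \in A by move/(allP allA).
have e2' : last w (s1 :: a :: c) = s2 by rewrite e2.
rewrite /cycle rcons_path e2'; apply/andP; split.
  have pA : path (adj_in A) s1 (a :: c) by apply: sub_path pc.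
  rewrite -[path _ _ _]/(adj_in A w s1 && path (adj_in A) s1 (a :: c)) pA andbT.
  by rewrite /adj_in w1 wA inA // !inE eqxx orbT.
rewrite /adj_in [adj s2 w]adj_sym w2 wA andbT; apply: inA.
by rewrite -e2' mem_last.
Qed.

(** Otherwise every vertex of [B] has a neighbour in [B] different from any prescribed vertex, so a
    path in [B] can always be extended at its front, until it has more vertices than the graph. *)
Lemma acyclic_one_degenerate (G : sgraph) (A : {set vert G}) :
  (forall c : seq (vert G), all (mem A) c -> uniq c -> 3 <= size c ->
     ~~ cycle (adj_in A) c) -> one_degenerate A.
Proof.
move=> acyc B BA B0; apply: NNPP => nw.
have two w t : w \in B -> exists y, [/\ y \in B, adj w y & y != t].
  move=> wB; apply: NNPP => ny; apply: nw; exists w => // x y xB yB wx wy.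
  have eq_t z : z \in B -> adj w z -> z = t.
    by move=> zB wz; apply/eqP/negPn/negP=> zt; apply: ny; exists z.
  by rewrite (eq_t x) // (eq_t y).
have long k : exists x s, [/\ size s = k, uniq (x :: s), all (mem B) (x :: s)
    & path (@adj G) x s].
  elim: k => [|k [x [s [sk us sB ps]]]].
    by have [x xB] := set0Pn _ B0; exists x, [::]; rewrite /= xB.
  have xB : x \in B by case/andP: sB.
  (* The vertex to avoid is the second one of the path. For a one-vertex path the default is [x]
     itself, which its neighbours avoid anyway. *)
  have [y [yB xy yh]] := two x (head x s) xB.
  case: (boolP (y \in x :: s)) => [|ys]; last first.
    exists y, (x :: s); split; rewrite /= ?sk //.
    - by rewrite ys -cons_uniq.
    - by rewrite yB.
    - by rewrite adj_sym xy.
  rewrite inE eq_sym (negPf (adj_neq xy)) /= => ys.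
  (* If [y] is already on the path, the part up to [y] closes to a cycle; as [y] is not the second
     vertex, it has at least 3 vertices. *)
  case/splitPr: s / ys sk us sB ps yh => s1 s2 _ us sB ps yh; exfalso.
  have s1n : s1 != [::] by case: s1 us sB ps yh => //=; rewrite eqxx.
  move: us; rewrite -cat_cons -cat_rcons rcons_cons cat_uniq => /and3P [us _ _].
  move: sB; rewrite -cat_cons -cat_rcons rcons_cons all_cat => /andP [sB _].
  move: ps; rewrite -cat_rcons cat_path => /andP [ps _].
  have inA z : z \in x :: rcons s1 y -> z \in A.
    by move/(allP sB); apply: (subsetP BA).
  have allA : all (mem A) (x :: rcons s1 y) by apply/allP.
  have s3 : 3 <= size (x :: rcons s1 y) by case: (s1) s1n => //= *; rewrite size_rcons.
  have /negP := acyc _ allA us s3; apply.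
  rewrite /cycle rcons_path last_rcons; apply/andP; split; last first.
    by rewrite /adj_in adj_sym xy !inA // ?inE ?eqxx // mem_rcons inE eqxx orbT.
  move: ps inA {yh sB us allA s3 xy two}; elim: (rcons s1 y) (x) => //= b d IH t.
  move=> /andP [tb pd] inA; rewrite IH ?andbT // => [|z zd].
    by rewrite /adj_in tb !inA // !inE ?eqxx ?orbT.
  by apply: inA; rewrite inE zd orbT.
have [x [s [sk us _ _]]] := long #|vert G|.
by have := max_card (mem (x :: s)); rewrite (card_uniqP us) /= sk ltnn.
Qed.

Lemma is_path_graph_of_seq (G : sgraph) (s : seq (vert G)) :
  uniq s -> (forall x, x \in s) ->
  (forall x y, adj x y =
     ((index x s).+1 == index y s) || ((index y s).+1 == index x s)) ->
  is_path_graph G (size s).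
Proof.
move=> us all_s adjE.
have lt_s x : index x s < size s by rewrite index_mem.
exists (fun x => Ordinal (lt_s x)); split=> //.
exists (tnth (in_tuple s)) => [x|i].
  by rewrite (tnth_nth x) /= nth_index.
by apply/val_inj; rewrite /= (tnth_nth (tnth (in_tuple s) i)) /= index_uniq.
Qed.

(** * Connected triangle-free graphs with no full star-cutset *)

Section NoStarCutset.
Context (G : sgraph).
Hypothesis conn : connected_graph G.
Hypothesis tfree : triangle_free G.
Hypothesis no_cut : no_full_star_cutset G.

Lemma triangle_free_nonadj (x y z : vert G) : adj x y -> adj x z -> ~~ adj y z.
Proof.
move=> xy xz; apply/negP=> yz.
by apply: (tfree (x := x) (y := y) (z := z)); rewrite xy yz xz.
Qed.

Lemma connect_off_star (u x y : vert G) :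
  x \notin closed_nbhd u -> y \notin closed_nbhd u ->
  connect (adj_out (closed_nbhd u)) x y.
Proof.
by move=> xN yN; apply/negPn/negP=> nc; apply: (no_cut (u := u)); exists x, y.
Qed.

(** Off the closed neighbourhood of [u] the vertex [x] is isolated, so any other remaining vertex
    would be cut off from it. *)
Lemma off_star_unique (u x y : vert G) :
  x \notin closed_nbhd u -> (forall z, adj x z -> z \in closed_nbhd u) ->
  y \notin closed_nbhd u -> y = x.
Proof.
move=> xN xz yN; have /connectP [[|z c] /=] := connect_off_star xN yN.
  by move=> _ ->.
by case/andP=> /and3P [/xz ->].
Qed.

Lemma connected_closed (S : {set vert G}) : S != set0 ->
  (forall x y, x \in S -> adj x y -> y \in S) -> forall x, x \in S.
Proof.
move=> /set0Pn [x0 x0S] clS x; have [_ /(_ x0 x) /connectP [c pc ->]] := conn.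
by elim: c x0 x0S pc => //= y c IH z zS /andP [/(clS _ _ zS) yS /IH]; apply.
Qed.

(** Follow a path [w], [u], [v], [x]. Off [N[v]] the vertex [w] is isolated, so all other vertices
    lie in [N[v]], and [u] has no neighbours but [w] and [v]. Then [x] is isolated off [N[u]], which
    excludes a fifth vertex. If the path stops earlier, it is the whole graph. *)
Lemma path_at_most4_of_low_degree (w : vert G) :
  (forall x y, adj w x -> adj w y -> x = y) -> path_at_most4 G.
Proof.
move=> w1.
have seq_path (s : seq (vert G)) : 0 < size s <= 4 -> uniq s ->
    (forall x, x \in s) ->
    {in s &, forall x y, adj x y =
     ((index x s).+1 == index y s) || ((index y s).+1 == index x s)} ->
    path_at_most4 G.
  move=> ss us all_s adjE; exists (size s); split=> //.
  by apply: is_path_graph_of_seq => // x y; apply: adjE.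
case: (pickP (adj w)) => [u wu|w0]; last first.
  apply: (seq_path [:: w]) => // [x|x y].
    rewrite inE -in_set1; apply: connected_closed.
      by apply/set0Pn; exists w; rewrite set11.
    by move=> a b /set1P -> ; rewrite w0.
  by rewrite !inE => /eqP -> /eqP ->; rewrite adj_irr /= eqxx.
have wu' := adj_neq wu; have uw : adj u w by rewrite adj_sym.
have wE t : adj w t = (t == u).
  by apply/idP/eqP=> [wt|->//]; apply: w1.
case: (pickP (fun v => adj u v && (v != w))) => [v /andP [uv vw]|u0]; last first.
  apply: (seq_path [:: w; u]) => [||x|x y] //=; first by rewrite inE wu'.
    rewrite !inE -in_set2; apply: connected_closed.
      by apply/set0Pn; exists w; rewrite set21.
    move=> a b /set2P [->|-> ub]; rewrite !inE; first by rewrite wE => ->; rewrite orbT.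
    by move/negbT: (u0 b); rewrite ub /= negbK => ->.
  by rewrite !inE => /orP [] /eqP -> /orP [] /eqP ->;
    rewrite ?adj_irr ?wu ?uw ?eqxx ?(negPf wu') ?eqxx //.
have uv' := adj_neq uv; have vu : adj v u by rewrite adj_sym.
have wv_nadj : ~~ adj w v by rewrite wE eq_sym.
have vw_nadj : ~~ adj v w by rewrite adj_sym.
have uN : u \in closed_nbhd v by rewrite in_closed_nbhd vu orbT.
have all_v x : x \notin closed_nbhd v -> x = w.
  apply: off_star_unique; first by rewrite in_closed_nbhd negb_or eq_sym vw.
  by move=> z; rewrite wE => /eqP ->.
have uE t : adj u t = (t == w) || (t == v).
  apply/idP/orP=> [ut|[]/eqP-> //].
  case: (boolP (t \in closed_nbhd v)) => [|/all_v ->]; last by left.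
  rewrite in_closed_nbhd => /orP [->|vt]; first by right.
  by have := triangle_free_nonadj uv ut; rewrite vt.
case: (pickP (fun x => adj v x && (x != u))) => [x /andP [vx xu]|v0]; last first.
  apply: (seq_path [:: w; u; v]) => [||x|x y] //=.
  - by rewrite !inE negb_or wu' eq_sym vw uv'.
  - case: (boolP (x \in closed_nbhd v)) => [|/all_v ->]; last by rewrite !inE eqxx.
    rewrite in_closed_nbhd !inE => /orP [->|vx]; first by rewrite !orbT.
    by move/negbT: (v0 x); rewrite vx /= negbK => ->; rewrite orbT.
  rewrite !inE => /or3P [] /eqP -> /or3P [] /eqP ->;
    rewrite ?adj_irr ?wu ?uw ?uv ?vu ?(negPf wv_nadj) ?(negPf vw_nadj) ?eqxx
     ?(negPf wu') ?(negPf uv') ?[w == v]eq_sym ?(negPf vw) ?eqxx //.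
have vx' := adj_neq vx; have xv : adj x v by rewrite adj_sym.
have xw : x != w by apply: contraTneq vx => ->.
have wx_nadj : ~~ adj w x by rewrite wE.
have xw_nadj : ~~ adj x w by rewrite adj_sym.
have ux_nadj : ~~ adj u x by rewrite uE negb_or xw eq_sym.
have xu_nadj : ~~ adj x u by rewrite adj_sym.
apply: (seq_path [:: w; u; v; x]) => [||y|y z] //=.
- by rewrite !inE !negb_or wu' [w == v]eq_sym vw [w == x]eq_sym xw uv' [u == x]eq_sym xu vx'.
- case: (boolP (y \in closed_nbhd u)) => [|yN].
    by rewrite in_closed_nbhd uE !inE => /or3P [] ->; rewrite ?orbT.
  suff -> : y = x by rewrite !inE eqxx !orbT.
  apply: (off_star_unique (u := u)) => // [|z xz].
    by rewrite in_closed_nbhd negb_or xu.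
  rewrite in_closed_nbhd uE; case: (boolP (z \in closed_nbhd v)) => [|/all_v ->].
    rewrite in_closed_nbhd => /orP [-> //|vz]; first by rewrite !orbT.
    by have := triangle_free_nonadj vx vz; rewrite xz.
  by rewrite eqxx !orbT.
have [wu0 [uw0 [uv0 [vw0 [wv0 vu0]]]]] : (w == u) = false /\ (u == w) = false /\
    (u == v) = false /\ (v == w) = false /\ (w == v) = false /\ (v == u) = false.
  by rewrite [u == w]eq_sym [w == v]eq_sym [v == u]eq_sym !(negPf wu', negPf uv', negPf vw).
have [xw0 [wx0 [xu0 [ux0 [vx0 xv0]]]]] : (x == w) = false /\ (w == x) = false /\
    (x == u) = false /\ (u == x) = false /\ (v == x) = false /\ (x == v) = false.
  by rewrite [w == x]eq_sym [u == x]eq_sym [x == v]eq_sym !(negPf xw, negPf xu, negPf vx').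
by rewrite !inE => /or4P [] /eqP -> /or4P [] /eqP ->;
  rewrite !(adj_irr, wu, uw, uv, vu, vx, xv, negPf wv_nadj, negPf vw_nadj,
    negPf wx_nadj, negPf xw_nadj, negPf ux_nadj, negPf xu_nadj, eqxx,
    (wu0, uw0, uv0, vw0, wv0, vu0), (xw0, wx0, xu0, ux0, vx0, xv0)).
Qed.

End NoStarCutset.

Lemma luxury_chandelier_of_apex (G : sgraph) (p : vert G) :
  triangle_free G -> no_full_star_cutset G ->
  (forall v t : vert G, exists2 x, adj v x & x != t) ->
  one_degenerate [set~ p] -> luxury_chandelier G.
Proof.
move=> tf nc mindeg dp.
have nadj := triangle_free_nonadj tf; have conn := connect_off_star nc.
have offp v t : adj p v -> adj v t -> t != p -> t \notin closed_nbhd p.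
  move=> pv vt tp; rewrite in_closed_nbhd negb_or tp; apply: nadj vt.
  by rewrite adj_sym.
(* Two neighbours of [v] other than [p] would be joined off [N[p]], giving a cycle through [v] that
   avoids [p]. *)
have deg1 v : adj p v -> deg_in [set~ p] v = 1.
  move=> pv; have [t vt tp] := mindeg v p.
  apply/eqP/cards1P; exists t; apply/setP=> t'; rewrite !inE.
  apply/andP/eqP=> [[t'p vt']|->//]; apply/eqP/negPn/negP=> tt'.
  suff /negP : ~~ connect (adj_out (closed_nbhd p)) t' t.
    by apply; apply: conn; apply: (offp v).
  apply: (acyclic_nbrs_not_connect dp _ tt' vt' vt); first by rewrite !inE eq_sym adj_neq.
  move=> x y /and3P [xy]; rewrite !in_closed_nbhd !negb_or !inE xy.
  move=> /andP [-> px] /andP [-> py] /=.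
  by apply/andP; split; [apply: contraNneq px => ->|apply: contraNneq py => ->].
have degp v : v != p -> deg_in [set~ p] v = 1 -> adj p v.
  move=> vp /eqP /cards1P [t /setP et].
  have [x vx xt] := mindeg v t; have := et x; rewrite !inE vx (negPf xt) andbT.
  by move/negbFE/eqP => <-; rewrite adj_sym.
exists p; split.
- have symA : connect_sym (adj_in [set~ p]).
    by apply: sym_connect_sym => x y; rewrite /adj_in adj_sym [_ && (y \in _)]andbC.
  split; last by move=> c; apply: one_degenerate_acyclic.
    by have [x px _] := mindeg p p; apply/set0Pn; exists x; rewrite !inE eq_sym adj_neq.
  (* Every vertex other than [p] is off [N[p]] or has a neighbour there, and the graph off [N[p]] is
     connected. *)
  have to_off x : x \in [set~ p] ->
      exists2 x', x' \notin closed_nbhd p & connect (adj_in [set~ p]) x x'.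
    rewrite !inE => xp; case: (boolP (adj p x)) => px; last first.
      by exists x => //; rewrite in_closed_nbhd negb_or xp.
    have [t xt tp] := mindeg x p; exists t; first exact: (offp x).
    by apply: connect1; rewrite /adj_in xt !inE xp.
  move=> x y /to_off [x' x'N xx'] /to_off [y' y'N yy'].
  apply: (connect_trans xx'); rewrite symA; apply: (connect_trans yy').
  apply: connect_sub (conn _ _ _ y'N x'N) => a b /and3P [ab].
  rewrite !in_closed_nbhd !negb_or => /andP [ap _] /andP [bp _].
  by apply: connect1; rewrite /adj_in ab !inE ap.
- by move=> v vp; apply/idP/eqP=> [/deg1|/(degp _ vp)].
move=> v w vp wp v1 vw.
have pv := degp _ vp v1.
have wv : adj w v by rewrite adj_sym.
have n_pw : ~~ adj p w by apply: nadj vw; rewrite adj_sym.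
have [s ws sv] := mindeg w v.
have wnp t : adj w t -> t != p by apply: contraTneq => ->; rewrite adj_sym.
apply/eqP/cards2P; exists v, s; split; first by rewrite eq_sym.
apply/setP=> t; rewrite !inE.
apply/andP/orP=> [[tp wt]|[]/eqP->//]; last by rewrite wnp.
case: (eqVneq t v) => [|tv]; [by left|right].
(* A third neighbour [t] of [w] would be joined to [s] off [N[v]]. As both [p] and [w] lie in
   [N[v]], this gives a cycle through [w] avoiding [p]. *)
apply/negPn/negP=> ts; suff /negP : ~~ connect (adj_out (closed_nbhd v)) t s.
  have offv x : adj w x -> x != v -> x \notin closed_nbhd v.
    by move=> wx xv; rewrite in_closed_nbhd negb_or xv; apply: nadj wx.
  by apply; apply: conn; apply: offv.
apply: (acyclic_nbrs_not_connect dp _ ts wt ws); first by rewrite !inE.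
move=> x y /and3P [xy]; rewrite !in_closed_nbhd !negb_or !inE xy.
move=> /andP [_ vx] /andP [_ vy] /=; have vp' : adj v p by rewrite adj_sym.
by apply/and4P; split; [apply: contraNneq vx => ->|apply: contraNneq vy => ->
  |apply: contraNneq vx => ->|apply: contraNneq vy => ->].
Qed.

(** * Frames for rooted forests with an apex *)

Section RootedForest.
Context (G : sgraph) (p : vert G).

(** The depth equation keeps a root, at depth 0, from being a child whatever its value of [par]. *)
Definition child (par : vert G -> vert G) (dep : vert G -> nat) (x y : vert G) :=
  (par x == y) && (dep x == (dep y).+1).

(** By [rf_leaf] a neighbour of [p] has no children, so its frame can be stretched to the right past
    the frame of [p] without meeting descendants. *)
Record rooted_forest (B : {set vert G}) par dep : Prop := RootedForest {
  rf_adj : {in B &, forall x y, adj x y = child par dep x y || child par dep y x};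
  rf_root : {in B, forall x, dep x != 0 -> par x \in B /\ child par dep x (par x)};
  rf_leaf : {in B &, forall x y, adj p y -> ~~ child par dep x y} }.

Hypothesis nbr_indep : forall x y, adj p x -> adj p y -> ~~ adj x y.
Hypothesis nbr_leaf :
  forall v x y, adj p v -> x != p -> y != p -> adj v x -> adj v y -> x = y.

(** Induction on the size of [B]. A vertex [w] with at most one neighbour in [B] is put back as an
    isolated root, as a child of its neighbour, or as a new root above it. *)
Lemma exists_rooted_forest : one_degenerate [set~ p] ->
  forall B : {set vert G}, B \subset [set~ p] ->
  exists par dep, rooted_forest B par dep.
Proof.
move=> dp B; move: {2}#|B| (erefl #|B|) => n; elim: n B => [|n IH] B cB BA.
  have B0 : B = set0 by apply/eqP; rewrite -cards_eq0 cB.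
  by exists (fun x => x), (fun=> 0); rewrite B0; split=> x; rewrite inE.
have B0 : B != set0 by rewrite -cards_eq0 cB.
have [w wB w1] := dp B BA B0.
have cB' : #|B :\ w| = n by apply/eqP; rewrite -eqSS -cB (cardsD1 w B) wB.
have B'A : B :\ w \subset [set~ p] := subset_trans (subD1set _ _) BA.
have [par [dep [hadj hroot hleaf]]] := IH _ cB' B'A.
have inB' x : x \in B -> x != w -> x \in B :\ w by rewrite !inE => -> ->.
have np x : x \in B -> x != p by move/(subsetP BA); rewrite !inE.
have noparw x d : x \in B -> x != w -> dep x = d.+1 -> par x != w.
  move=> xB xw dx; have [|+ _] := hroot x (inB' _ xB xw); first by rewrite dx.
  by rewrite !inE => /andP [].
case: (pickP (fun u => (u \in B) && adj w u)) => [u /andP [uB wu]|w0]; last first.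
  exists (fun x => if x == w then w else par x), (fun x => if x == w then 0 else dep x).
  have nadjw x : x \in B -> adj w x = false by move=> xB; have := w0 x; rewrite xB.
  split.
  - move=> x y xB yB; rewrite /child.
    case: (eqVneq x w) => [->|xw]; case: (eqVneq y w) => [->|yw].
    + by rewrite adj_irr eqxx.
    + rewrite nadjw //= ?andbF /=; apply/esym/negP=> /andP [/eqP ey /eqP dy].
      by have := noparw _ _ yB yw dy; rewrite ey eqxx.
    + rewrite adj_sym nadjw //= ?andbF ?orbF; apply/esym/negP=> /andP [/eqP ex /eqP dx].
      by have := noparw _ _ xB xw dx; rewrite ex eqxx.
    + by rewrite hadj ?inB'.
  - move=> x xB; rewrite /child; case: (eqVneq x w) => [_|xw] //.
    move=> dx; have [] := hroot x (inB' _ xB xw) dx; rewrite !inE => /andP [pw pB].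
    by rewrite (negPf pw).
  - move=> x y xB yB py; rewrite /child.
    case: (eqVneq x w) => [_|xw]; case: (eqVneq y w) => [ey|yw] //=.
    + apply/negP=> /andP [/eqP ex /eqP dx].
      by have := noparw _ _ xB xw dx; rewrite ex ey eqxx.
    + by apply: hleaf => //; apply: inB'.
have uw : u != w by rewrite eq_sym adj_neq.
have wE x : x \in B -> adj w x = (x == u).
  by move=> xB; apply/idP/eqP=> [wx|->//]; apply: w1.
have u_in := inB' _ uB uw.
case: (boolP (adj p u)) => pu; last first.
  exists (fun x => if x == w then u else par x),
    (fun x => if x == w then (dep u).+1 else dep x).
  split.
  - move=> x y xB yB; rewrite /child.
    case: (eqVneq x w) => [->|xw]; case: (eqVneq y w) => [->|yw].
    + by rewrite adj_irr (negPf uw).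
    + rewrite wE // [u == y]eq_sym; case: (eqVneq y u) => [->|yu]; first by rewrite eqxx.
      rewrite /=; apply/esym/negP=> /andP [/eqP ey /eqP dy].
      by have := noparw _ _ yB yw dy; rewrite ey eqxx.
    + rewrite adj_sym wE // [u == x]eq_sym; case: (eqVneq x u) => [->|xu].
        by rewrite eqxx orbT.
      rewrite /= ?orbF; apply/esym/negP=> /andP [/eqP ex /eqP dx].
      by have := noparw _ _ xB xw dx; rewrite ex eqxx.
    + by rewrite hadj ?inB'.
  - move=> x xB; rewrite /child; case: (eqVneq x w) => [_|xw].
      by move=> _; rewrite (negPf uw) !eqxx.
    move=> dx; have [] := hroot x (inB' _ xB xw) dx; rewrite !inE => /andP [pw pB].
    by rewrite (negPf pw).
  - move=> x y xB yB py; rewrite /child.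
    case: (eqVneq x w) => [_|xw]; case: (eqVneq y w) => [ey|yw] //=.
    + by rewrite ey (negPf uw).
    + suff /negPf -> : u != y by [].
      by apply: contraNneq pu => ->.
    + apply/negP=> /andP [/eqP ex /eqP dx].
      by have := noparw _ _ xB xw dx; rewrite ex ey eqxx.
    + by apply: hleaf => //; apply: inB'.
(* The neighbour [u] of [w] must stay a leaf: it is isolated in [B :\ w], so
   [w] becomes a root and [u] its child. *)
have n_pw : ~~ adj p w.
  by apply/negP=> pw; have := nbr_indep pw pu; rewrite wu.
have uw' : adj u w by rewrite adj_sym.
have nadju x : x \in B -> adj u x -> x = w.
  by move=> xB ux; apply: nbr_leaf pu _ _ ux uw'; apply: np.
have nchu x : x \in B -> x != w -> ~~ child par dep x u.
  by move=> xB xw; apply: hleaf => //; apply: inB'.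
exists (fun x => if x == u then w else par x),
  (fun x => if x == w then 0 else if x == u then 1 else dep x).
have noparu x d : x \in B -> x != w -> dep x = d.+1 -> par x != u.
  move=> xB xw dx; apply: contraNneq (nchu _ xB xw) => pxu.
  have [|_] := hroot x (inB' _ xB xw); first by rewrite dx.
  by rewrite pxu.
split.
- move=> x y xB yB; rewrite /child.
  case: (eqVneq x w) => [->|xw]; case: (eqVneq y w) => [->|yw].
  + by rewrite adj_irr /= ?andbF.
  + rewrite wE //= ?andbF /=; case: (eqVneq y u) => [_|yu]; first by rewrite !eqxx.
    apply/esym/negP=> /andP [/eqP ey /eqP dy].
    by have := noparw _ _ yB yw dy; rewrite ey eqxx.
  + rewrite adj_sym wE //= ?andbF ?orbF; case: (eqVneq x u) => [_|xu]; first by rewrite !eqxx.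
    apply/esym/negP=> /andP [/eqP ex /eqP dx].
    by have := noparw _ _ xB xw dx; rewrite ex eqxx.
  case: (eqVneq x u) => [->|xu]; case: (eqVneq y u) => [->|yu].
  + by rewrite adj_irr /= ?andbF.
  + rewrite [w == y]eq_sym (negPf yw) /=.
    have -> : adj u y = false by apply: contraNF yw => /(nadju _ yB) ->.
    apply/esym/negP=> /andP [/eqP ey /eqP dy].
    by have := noparu _ _ yB yw dy; rewrite ey eqxx.
  + rewrite [w == x]eq_sym (negPf xw) ?orbF adj_sym.
    have -> : adj u x = false by apply: contraNF xw => /(nadju _ xB) ->.
    apply/esym/negP=> /andP [/eqP ex /eqP dx].
    by have := noparu _ _ xB xw dx; rewrite ex eqxx.
  + by rewrite hadj ?inB'.
- move=> x xB; rewrite /child; case: (eqVneq x w) => [->|xw] //.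
  case: (eqVneq x u) => [_|xu]; first by rewrite !eqxx.
  move=> dx; have [] := hroot x (inB' _ xB xw) dx; rewrite !inE => /andP [pw pB].
  rewrite (negPf pw) /child eqxx /= => /eqP dpx.
  case: (eqVneq (par x) u) => [e|_]; last by rewrite dpx !eqxx.
  by have := noparu _ _ xB xw dpx; rewrite e eqxx.
- move=> x y xB yB py; rewrite /child.
  have yw : y != w by apply: contraTneq py => ->.
  rewrite (negPf yw); case: (eqVneq x w) => [->|xw]; first by rewrite ?andbF.
  case: (eqVneq x u) => [_|xu]; first by rewrite [w == y]eq_sym (negPf yw).
  case: (eqVneq y u) => [->|yu]; last by apply: hleaf => //; apply: inB'.
  apply/negP=> /andP [/eqP ex /eqP dx].
  by have := noparu _ _ xB xw dx; rewrite ex eqxx.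
Qed.

End RootedForest.

(** * An explicit layout for a rooted forest *)

Section ForestLayout.
Context (G : sgraph) (p : vert G) (par : vert G -> vert G) (dep : vert G -> nat).
Hypothesis RF : rooted_forest p [set~ p] par dep.

Let n := #|vert G|.
(** The digits [2 * rk x + 1] are odd, so sibling ranges of one unit each leave a gap, and the upper
    ends [2 * rk x + 2] stay below [base], strictly inside the parent. *)
Let base := (2 * n + 2)%N.
Let D := \max_x dep x.
Let rk (x : vert G) : nat := enum_rank x.
Let wd k := expn base (D.+1 - k).

Let dep_le x : dep x <= D. Proof. exact: leq_bigmax. Qed.
Let rk_lt x : rk x < n. Proof. exact: ltn_ord. Qed.
Let wd_gt0 k : 0 < wd k. Proof. by rewrite expn_gt0 /base addn2. Qed.
Let wdS k : k <= D -> wd k = (base * wd k.+1)%N.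
Proof. by move=> kD; rewrite /wd subSn // subSS expnS. Qed.

(* The vertical range of [x] is the digit [2 * rk x + 1], in base
   [2 * #|V| + 2], of the vertical range of its parent. *)
Fixpoint low_at k (x : vert G) : nat :=
  match k with
  | 0 => (wd 0 * (2 * rk x + 1))%N
  | k'.+1 => (low_at k' (par x) + wd k * (2 * rk x + 1))%N
  end.
Let low x := low_at (dep x) x.
Let high x := (low x + wd (dep x))%N.

Let ch := child par dep.

Let child_low x y : ch x y -> low x = (low y + wd (dep x) * (2 * rk x + 1))%N.
Proof. by case/andP=> /eqP <- /eqP dx; rewrite /low dx. Qed.

Let low_gt0 x : 0 < low x.
Proof.
rewrite /low; case: (dep x) => [|k] /=; first by have := wd_gt0 0; nia.
by have := wd_gt0 k.+1; nia.
Qed.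

Let child_nested x y : ch x y -> low y < low x /\ high x < high y.
Proof.
move=> xy; rewrite /high (child_low xy); case/andP: xy => _ /eqP dx.
have -> : wd (dep y) = (base * wd (dep x))%N by rewrite dx wdS.
have := wd_gt0 (dep x); have := rk_lt x; rewrite /base; nia.
Qed.

Let high_lt x : x != p -> high x < base * wd 0.
Proof.
move: {2}(dep x) (erefl (dep x)) => k; elim: k x => [|k IH] x dx xp.
  have := rk_lt x; have := wd_gt0 0; rewrite /high /low dx /= /base; nia.
have xA : x \in [set~ p] by rewrite !inE.
have [|parA xpar] := rf_root RF xA; first by rewrite dx.
have [_ /ltn_trans] := child_nested xpar; apply; apply: IH.
  by case/andP: xpar => _; rewrite dx eqSS => /eqP ->.
by move: parA; rewrite !inE.
Qed.

Let apart x y := (high x < low y) || (high y < low x).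

Let apart_nested x y x' y' : apart x' y' -> low x' <= low x -> high x <= high x' ->
  low y' <= low y -> high y <= high y' -> apart x y.
Proof.
by case/orP=> h lx hx ly hy; apply/orP; [left|right];
  [apply: leq_ltn_trans hx (leq_trans h ly)|apply: leq_ltn_trans hy (leq_trans h lx)].
Qed.

Let rank_apart (a b r s w : nat) : 0 < w -> r != s -> a = b ->
  (a + w * (2 * r + 1) + w < b + w * (2 * s + 1)) ||
  (b + w * (2 * s + 1) + w < a + w * (2 * r + 1)).
Proof. by move=> w0 rs ->; case: (ltngtP r s) rs => // rs _; apply/orP; [left|right]; nia. Qed.

Let rk_neq x y : x != y -> rk x != rk y.
Proof. by apply: contraNneq => /val_inj /enum_rank_inj ->. Qed.

(** Induction on the depth of [y]. At equal depths either the digits differ below a common parent or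
    the parents are already apart; otherwise [y] is replaced by its parent. In the second
    alternative [x] is a proper ancestor of [y]. *)
Let vertical_cases x y : x != p -> y != p -> x != y -> dep x <= dep y ->
  apart x y \/
  [/\ low x < low y, high y < high x, dep x < dep y, exists2 z, z != p & ch z x
    & ch y x \/ (dep x).+1 < dep y].
Proof.
move: {2}(dep y) (erefl (dep y)) => k; elim: k x y => [|k IH] x y dy xp yp xy.
  rewrite dy leqn0 => /eqP dx; left; rewrite /apart /high /low dx dy /=.
  by have := @rank_apart 0 0 _ _ _ (wd_gt0 0) (rk_neq xy) erefl; rewrite !add0n.
have yA : y \in [set~ p] by rewrite !inE.
have [|parA ypar] := rf_root RF yA; first by rewrite dy.
have pyp : par y != p by move: parA; rewrite !inE.
have dpy : dep (par y) = k by case/andP: ypar => _; rewrite dy eqSS => /eqP.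
have [ly hy] := child_nested ypar.
rewrite dy leq_eqVlt => /predU1P [dx|]; last rewrite ltnS => dx.
  have xA : x \in [set~ p] by rewrite !inE.
  have [|parxA xpar] := rf_root RF xA; first by rewrite dx.
  have pxp : par x != p by move: parxA; rewrite !inE.
  have dpx : dep (par x) = k by case/andP: xpar => _; rewrite dx eqSS => /eqP.
  have [lx hx] := child_nested xpar; left.
  case: (eqVneq (par x) (par y)) => [e|ne].
    rewrite /apart /high (child_low xpar) (child_low ypar) dx dy.
    by apply: rank_apart; rewrite ?wd_gt0 ?rk_neq ?e.
  have [||[_ _ +]] := IH (par x) (par y) dpy pxp pyp ne; rewrite ?dpx ?dpy ?ltnn //.
  by move/apart_nested; apply; apply: ltnW.
case: (eqVneq x (par y)) => [e|ne].
  right; rewrite e; split=> //; first by rewrite dpy.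
    by exists y.
  by left.
have [|ap|[lxy hxy dxy cx _]] := IH x (par y) dpy xp pyp ne; first by rewrite dpy.
  by left; apply: apart_nested ap _ _ _ _ => //; apply: ltnW.
right; split=> //; [exact: ltn_trans ly|exact: ltn_trans hxy|].
by right; rewrite ltnS -dpy.
Qed.

(** The interval from [2 * d + 1] to [2 * d + 4] at depth [d] overlaps the one at depth [d + 1],
    which ends further right, and ends before depth [d + 2] begins. The right side of [p], at [X],
    is passed only by its neighbours. *)
Let X := (2 * D + 5)%N.
Let left_of x := if x == p then 0%N else (2 * dep x + 1)%N.
Let right_of x := if x == p then X else if adj p x then X.+1 else (2 * dep x + 4)%N.
Let bot_of x := if x == p then 0%N else low x.
Let top_of x := if x == p then (base * wd 0)%N else high x.

Let left_right x : left_of x < right_of x.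
Proof.
by have := dep_le x; rewrite /left_of /right_of /X; case: ifP => _; [|case: ifP => _]; lia.
Qed.

Let bot_top x : bot_of x < top_of x.
Proof.
rewrite /bot_of /top_of /high; case: ifP => _.
  by rewrite muln_gt0 wd_gt0 /base addn2.
by have := wd_gt0 (dep x); lia.
Qed.

Let INR_lt (a b : nat) : a < b -> (INR a < INR b)%R.
Proof. by move=> /ltP; apply: lt_INR. Qed.

Let Fr x := Frame (INR_lt (left_right x)) (INR_lt (bot_top x)).

Let crosses_nat x y : [&& left_of x < left_of y, left_of y < right_of x,
    right_of x < right_of y, bot_of x < bot_of y & top_of y < top_of x] ->
  crosses (Fr x) (Fr y).
Proof. by case/and5P=> *; split; [split; [|split]|split]; apply: INR_lt. Qed.

Let inside_nat x y : [&& left_of y < left_of x, right_of x < right_of y,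
    bot_of y < bot_of x & top_of x < top_of y] ->
  inside (Fr x) (Fr y).
Proof. by case/and4P=> *; split; split; apply: INR_lt. Qed.

Let separated_nat x y : [|| right_of x < left_of y, right_of y < left_of x,
    top_of x < bot_of y | top_of y < bot_of x] ->
  separated (Fr x) (Fr y).
Proof.
by case/or4P=> /INR_lt h; [left|right; left|right; right; left|right; right; right].
Qed.

Let child_crosses x y : x != p -> y != p -> ch x y -> crosses (Fr y) (Fr x).
Proof.
move=> xp yp xy; apply: crosses_nat.
rewrite /left_of /right_of /bot_of /top_of (negPf xp) (negPf yp).
have [-> ->] := child_nested xy.
have /negPf -> : ~~ adj p y.
  by apply: contraL xy => py; apply: (rf_leaf RF); rewrite ?inE.
case/andP: xy => _ /eqP dx; have := dep_le x; rewrite /X dx; case: ifP; lia.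
Qed.

Let apex_crosses x : adj p x -> crosses (Fr p) (Fr x).
Proof.
move=> px; have xp : x != p by rewrite eq_sym adj_neq.
apply: crosses_nat; rewrite /left_of /right_of /bot_of /top_of eqxx (negPf xp) px.
by rewrite low_gt0 high_lt // /X; have := dep_le x; lia.
Qed.

Let apex_inside x : x != p -> ~~ adj p x -> inside (Fr x) (Fr p).
Proof.
move=> xp /negPf px; apply: inside_nat.
rewrite /left_of /right_of /bot_of /top_of eqxx (negPf xp) px.
by rewrite low_gt0 high_lt // /X; have := dep_le x; lia.
Qed.

Let nonadj_separated x y : x != p -> y != p -> x != y -> ~~ adj x y ->
  dep x <= dep y -> separated (Fr x) (Fr y).
Proof.
move=> xp yp xy nxy dxy; apply: separated_nat.
rewrite /left_of /right_of /bot_of /top_of (negPf xp) (negPf yp).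
case: (vertical_cases xp yp xy dxy) => [/orP [->|->]|]; rewrite ?orbT //.
case=> _ _ _ [z zp zx] [yx|dxy'].
  by case/negP: nxy; rewrite (rf_adj RF) ?inE // -/ch yx orbT.
(* Having a child, [x] is not a neighbour of [p], so its frame is not stretched and ends before a
   descendant two or more levels down begins. *)
have /negPf -> : ~~ adj p x.
  by apply: contraL zx => px; apply: (rf_leaf RF); rewrite ?inE.
by apply/orP; left; lia.
Qed.

Lemma forest_restricted_frame_graph : restricted_frame_graph G.
Proof.
apply: (@restricted_frame_graph_of_layout _ p Fr) => u v.
  case: (eqVneq u p) => [-> /apex_crosses|up]; first by left.
  case: (eqVneq v p) => [->|vp].
    by rewrite adj_sym => /apex_crosses; right.
  rewrite (rf_adj RF) ?inE // => /orP [] /child_crosses; first by right; auto.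
  by left; auto.
move=> uv; case: (eqVneq u p) => [eu nuv|up].
  by subst u; constructor 2; split=> //; apply: apex_inside; rewrite // eq_sym.
case: (eqVneq v p) => [->|vp].
  by rewrite adj_sym => nuv; constructor 1; split=> //; apply: apex_inside.
move=> nuv; constructor 3; case: (leqP (dep u) (dep v)) => [|/ltnW] d.
  exact: nonadj_separated.
by apply: separated_sym; apply: nonadj_separated; rewrite // 1?eq_sym // adj_sym.
Qed.

End ForestLayout.

(** The common feature of paths and luxury chandeliers that passes to subdivisions and suffices for
    the layout: the neighbours of [p] have degree at most 1 in the forest. *)
Definition leafy_apex (G : sgraph) (p : vert G) : Prop :=
  one_degenerate [set~ p] /\
  forall v x y : vert G, adj p v -> x != p -> y != p -> adj v x -> adj v y -> x = y.

Lemma leafy_apex_restricted_frame_graph (G : sgraph) (p : vert G) :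
  triangle_free G -> leafy_apex p -> restricted_frame_graph G.
Proof.
move=> tf [dp leaf].
have [par [dep RF]] :=
  exists_rooted_forest (triangle_free_nonadj tf (x := p)) leaf dp (subxx _).
exact: forest_restricted_frame_graph RF.
Qed.

(** * Subdivisions *)

Lemma infix2_nth (T : eqType) (x0 x y : T) (s : seq T) :
  infix [:: x; y] s <->
  exists2 i, i.+1 < size s & nth x0 s i = x /\ nth x0 s i.+1 = y.
Proof.
split=> [/infixP [s1 [s2 ->]]|[i lt_i [<- <-]]].
  exists (size s1); first by rewrite !size_cat /=; lia.
  have lt_S : ((size s1).+1 < size s1) = false by lia.
  by rewrite !nth_cat ltnn subnn lt_S subSnn.
apply/infixP; exists (take i s), (drop i.+2 s).
by rewrite -[LHS](cat_take_drop i s) (drop_nth x0 (ltnW lt_i)) (drop_nth x0 lt_i).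
Qed.

Section Subdivision.
Context (H Hs : sgraph) (f : vert H -> vert Hs)
  (P : vert H -> vert H -> seq (vert Hs)).
Hypothesis f_inj : injective f.
Hypothesis P_rev : forall u v, adj u v -> P v u = rev (P u v).
Hypothesis P_uniq : forall u v, adj u v ->
  uniq (P u v) /\ forall w, w \in P u v -> w \notin codom f.
Hypothesis P_disj : forall u v u' v', adj u v -> adj u' v' ->
  ~~ (((u == u') && (v == v')) || ((u == v') && (v == u'))) ->
  all (fun w => w \notin P u' v') (P u v).
Hypothesis P_cover :
  forall w, w \in codom f \/ exists u v, adj u v /\ w \in P u v.
Hypothesis P_adj : forall x y, adj x y <->
  exists u v, adj u v /\ infix [:: x; y] (f u :: rcons (P u v) (f v)).

Definition len u v := size (P u v).
(** Positions along the path of the edge [uv] run from 0 at [f u] to [(len u v).+1] at [f v]; beyond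
    that the default [f u] is returned. *)
Definition pt u v i := nth (f u) (f u :: rcons (P u v) (f v)) i.

Lemma pt0 u v : pt u v 0 = f u. Proof. by []. Qed.

Lemma pt_last u v : pt u v (len u v).+1 = f v.
Proof. by rewrite /pt /= nth_rcons ltnn eqxx. Qed.

Lemma pt_mem u v i : 0 < i <= len u v -> pt u v i \in P u v.
Proof.
by case: i => // i /= li; rewrite /pt /= nth_rcons li; apply: mem_nth.
Qed.

Lemma mem_pt u v w : w \in P u v -> exists2 i, 0 < i <= len u v & w = pt u v i.
Proof.
move=> wP; exists (index w (P u v)).+1; first by rewrite ltnS /= index_mem.
by rewrite /pt /= nth_rcons index_mem wP nth_index.
Qed.

Lemma len_sym u v : adj u v -> len v u = len u v.
Proof. by move=> /P_rev e; rewrite /len e size_rev. Qed.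

Lemma pt_sym u v i : adj u v -> i <= (len u v).+1 ->
  pt v u i = pt u v ((len u v).+1 - i).
Proof.
move=> uv li; rewrite /pt P_rev // -rev_cons -rev_rcons rcons_cons.
rewrite (set_nth_default (f u)) ?size_rev /= ?size_rcons // nth_rev /= ?size_rcons //.
Qed.

Lemma pt_inj u v i j : adj u v -> i <= (len u v).+1 -> j <= (len u v).+1 ->
  pt u v i = pt u v j -> i = j.
Proof.
move=> uv li lj; move/eqP; rewrite nth_uniq /= ?size_rcons // => [/eqP //|].
have [uP fP] := P_uniq uv; rewrite mem_rcons inE negb_or rcons_uniq uP andbT.
rewrite (inj_eq f_inj) adj_neq //=.
by apply/andP; split; apply/negP=> /fP; rewrite codom_f.
Qed.

Lemma pt_internal_neq u v i w : adj u v -> 0 < i <= len u v -> pt u v i != f w.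
Proof.
move=> uv /pt_mem /(proj2 (P_uniq uv)); apply: contraNneq => ->.
exact: codom_f.
Qed.

(** An internal vertex is no branch vertex and lies on the path of a single edge, so the only
    ambiguity is the direction of that edge. *)
Lemma pt_eq u v u' v' i i' : adj u v -> adj u' v' ->
  0 < i <= len u v -> i' <= (len u' v').+1 -> pt u v i = pt u' v' i' ->
  [/\ u = u', v = v' & i' = i] \/ [/\ u = v', v = u' & i' = (len u v).+1 - i].
Proof.
move=> uv uv' li li' e.
have li'' : 0 < i' <= len u' v'.
  case: i' li' e => [_ e|i' li' e].
    by have := pt_internal_neq u' uv li; rewrite e eqxx.
  rewrite /= ltn_neqAle -ltnS li' andbT; apply/eqP=> ei.
  have := pt_internal_neq v' uv li.
  by rewrite e ei pt_last eqxx.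
case: (boolP (((u == u') && (v == v')) || ((u == v') && (v == u')))) => [|ne].
  case/orP=> /andP [/eqP eu /eqP ev]; subst u' v'.
    by left; split=> //; apply: (pt_inj uv) => //; lia.
  right; split=> //; have lv : len v u = len u v := len_sym uv.
  move: e; rewrite [RHS]pt_sym ?lv //; last by lia.
  move=> /(pt_inj uv); lia.
by have /allP /(_ _ (pt_mem li)) := P_disj uv uv' ne; rewrite e pt_mem.
Qed.

Lemma adj_pt x y : adj x y <-> exists u v i,
  [/\ adj u v, i <= len u v, x = pt u v i & y = pt u v i.+1].
Proof.
rewrite P_adj; split=> [[u [v [uv /(infix2_nth (f u)) [i li [<- <-]]]]]|].
  by exists u, v, i; split=> //; move: li; rewrite /= size_rcons.
move=> [u [v [i [uv li -> ->]]]]; exists u, v; split=> //.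
by apply/(infix2_nth (f u)); exists i; rewrite //= size_rcons.
Qed.

Lemma adj_pt_succ u v i : adj u v -> i <= len u v -> adj (pt u v i) (pt u v i.+1).
Proof. by move=> uv li; apply/adj_pt; exists u, v, i. Qed.

Lemma adj_internal u v i y : adj u v -> 0 < i <= len u v ->
  adj (pt u v i) y <-> y = pt u v i.-1 \/ y = pt u v i.+1.
Proof.
move=> uv li; split; last first.
  case=> ->; last by apply: adj_pt_succ => //; lia.
  have := @adj_pt_succ u v i.-1 uv; rewrite prednK; last by lia.
  by rewrite adj_sym; apply; lia.
case/adj_pt=> u' [v' [j [uv' lj e ->]]].
have [|[eu ev ej]|[eu ev ej]] := pt_eq uv uv' li _ e; first by lia.
  by subst u' v' j; right.
subst u' v'; left; rewrite pt_sym; last 2 first.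
- by rewrite adj_sym in uv'.
- by rewrite -(len_sym uv) ltnS.
by congr pt; move: lj; rewrite (len_sym uv); lia.
Qed.

Lemma adj_branch u y : adj (f u) y <-> exists2 v, adj u v & y = pt u v 1.
Proof.
split; last by case=> v uv ->; rewrite -(pt0 u v) adj_pt_succ.
case/adj_pt=> u' [v' [j [uv' lj e ->]]].
case: j lj e => [|j] lj e.
  by move: e; rewrite pt0 => /f_inj eu; subst u'; exists v'.
by have := @pt_internal_neq u' v' j.+1 u uv'; rewrite -e eqxx => /(_ lj).
Qed.

Lemma branch_nbr_inj u v v' : adj u v -> adj u v' -> pt u v 1 = pt u v' 1 -> v = v'.
Proof.
move=> uv uv' e; case: (posnP (len u v)) => l0; last first.
  have [||[]//|[eu ev _]] := pt_eq uv uv' (i := 1) (i' := 1) _ _ e; rewrite ?l0 //.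
  by subst v'; rewrite adj_irr in uv'.
have e1 : pt u v 1 = f v by rewrite -(pt_last u v) l0.
case: (posnP (len u v')) => l0'; last first.
  by have := @pt_internal_neq u v' 1 v uv'; rewrite -e e1 eqxx l0' => /(_ isT).
by apply: f_inj; rewrite -e1 e -(pt_last u v') l0'.
Qed.

Lemma vertex_cases x :
  (exists u, x = f u) \/
  (exists u v i, [/\ adj u v, 0 < i <= len u v & x = pt u v i]).
Proof.
case: (P_cover x) => [/codomP [u ->]|[u [v [uv /mem_pt [i li ->]]]]].
  by left; exists u.
by right; exists u, v, i.
Qed.

Lemma adj_branches u v : adj (f u) (f v) <-> adj u v /\ len u v = 0.
Proof.
split=> [/adj_branch [t ut e]|[uv l0]]; last first.
  by apply/adj_branch; exists v; rewrite // -(pt_last u v) l0.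
case: (posnP (len u t)) => l0.
  have et : pt u t 1 = f t by rewrite -(pt_last u t) l0.
  by move: e; rewrite et => /f_inj ->.
by have := @pt_internal_neq u t 1 v ut; rewrite -e eqxx l0 => /(_ isT).
Qed.

(** The two neighbours of an internal vertex are not adjacent: if one of them is internal, its own
    neighbours are known, and if both are ends, adjacency would force [len u v = 0]. So a triangle
    consists of branch vertices and comes from [H]. *)
Lemma subdivision_triangle_free : triangle_free H -> triangle_free Hs.
Proof.
move=> tf.
have no_int u v i y z : adj u v -> 0 < i <= len u v ->
    adj (pt u v i) y -> adj (pt u v i) z -> y != z -> ~~ adj y z.
  move=> uv li /(adj_internal _ uv li) hy /(adj_internal _ uv li) hz yz.
  apply/negP=> ayz.
  have {yz y z hy hz ayz} : adj (pt u v i.-1) (pt u v i.+1).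
    move: yz ayz; case: hy => ->; case: hz => -> //; rewrite ?eqxx //.
    by rewrite adj_sym.
  move/adj_pt=> [u' [v' [j [uv' lj e1 e2]]]].
  case: (posnP i.-1) => i1; last first.
    have li1 : 0 < i.-1 <= len u v by lia.
    have := adj_internal (pt u v i.+1) uv li1; rewrite e1 e2 => -[h _].
    have := h (adj_pt_succ uv' lj); rewrite -e2.
    by case=> /(pt_inj uv) h'; lia.
  case: (ltnP i (len u v)) => il.
    have li1 : 0 < i.+1 <= len u v by lia.
    have := adj_internal (pt u v i.-1) uv li1; rewrite e1 e2 => -[h _].
    have : adj (pt u' v' j.+1) (pt u' v' j) by rewrite adj_sym adj_pt_succ.
    by move/h; rewrite -e1 => -[] /(pt_inj uv) h'; lia.
  have ei : i = len u v by lia.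
  have : adj (f u) (f v).
    by rewrite -(pt_last u v) -ei -(pt0 u v) -i1 e1 e2 adj_pt_succ.
  by move/adj_branches=> [_]; lia.
move=> x y z /and3P [xy yz xz].
have yx : adj y x by rewrite adj_sym.
have zx : adj z x by rewrite adj_sym.
have zy : adj z y by rewrite adj_sym.
case: (vertex_cases x) => [[u eu]|[u [v [i [uv li ex]]]]]; last first.
  by have := no_int _ _ _ y z uv li; rewrite -ex xy xz yz adj_neq // => /(_ isT isT isT).
case: (vertex_cases y) => [[v ev]|[v' [v [i [uv li ex]]]]]; last first.
  by have := no_int _ _ _ x z uv li; rewrite -ex yx xz yz adj_neq // => /(_ isT isT isT).
case: (vertex_cases z) => [[w ew]|[w' [v' [i [uv li ex]]]]]; last first.
  by have := no_int _ _ _ x y uv li; rewrite -ex xy zx zy adj_neq // => /(_ isT isT isT).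
subst x y z; move/adj_branches: xy => [uv _]; move/adj_branches: yz => [vw _].
by move/adj_branches: xz => [uw _]; apply: (tf u v w); rewrite uv vw uw.
Qed.


Lemma subdivision_leafy_apex p : leafy_apex p -> leafy_apex (f p).
Proof.
move=> [dp leaf]; split; last first.
  move=> v x y /adj_branch [t pt_ ->] xp yp.
  case: (posnP (len p t)) => l0; last first.
    have li : 0 < 1 <= len p t by rewrite l0.
    move=> /(adj_internal _ pt_ li) [] /= ex; first by rewrite ex eqxx in xp.
    by move=> /(adj_internal _ pt_ li) [] /= ey; [rewrite ey eqxx in yp|rewrite ex ey].
  have et : pt p t 1 = f t by rewrite -(pt_last p t) l0.
  rewrite et => /adj_branch [a ta ex] /adj_branch [b tb ey]; rewrite ex ey.
  have np c : pt t c 1 != f p -> c != p.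
    apply: contraNneq => ->; have l0' : len t p = 0 by rewrite (len_sym pt_).
    by rewrite -(pt_last t p) l0'.
  by congr pt; apply: (leaf t) => //; apply: np; rewrite -?ex -?ey.
move=> B BA B0.
(* An internal vertex of [B] with a neighbour on its path outside [B] is the one sought. *)
case: (classic (exists u v i, [/\ adj u v, 0 < i <= len u v, pt u v i \in B
    & ~~ ((pt u v i.-1 \in B) && (pt u v i.+1 \in B))])).
  move=> [u [v [i [uv li xB nB]]]]; exists (pt u v i) => // x y xB' yB'.
  move=> /(adj_internal _ uv li) hx /(adj_internal _ uv li) hy.
  move: xB' yB' nB; case: hx => ->; case: hy => -> // -> ->; by [].
move=> full.
have nbr_in u v i : adj u v -> 0 < i <= len u v -> pt u v i \in B ->
    pt u v i.-1 \in B /\ pt u v i.+1 \in B.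
  move=> uv li xB; apply/andP/negPn/negP=> nB; apply: full.
  by exists u, v, i.
have last_in u v i : adj u v -> 0 < i <= (len u v).+1 -> pt u v i \in B -> f v \in B.
  move=> uv; move: {2}(_ - i) (erefl ((len u v).+1 - i)) => k.
  elim: k i => [|k IH] i ek li xB.
    by rewrite -(pt_last u v); have <- : i = (len u v).+1 by lia.
  apply: (IH i.+1); try lia.
  by have [] := nbr_in u v i uv; first by lia.
have nbr_branch u v : adj u v -> pt u v 1 \in B -> f v \in B.
  by move=> uv; apply: last_in.
(* Now [B] contains the whole path of each of its internal vertices, so distinct neighbours of [f u]
   in [B] lead to distinct neighbours of [u] in this set. *)
have [||u uB' u1] := dp [set u | f u \in B].
- apply/subsetP=> u; rewrite !inE => /(subsetP BA).
  by rewrite !inE (inj_eq f_inj).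
- apply/set0Pn; have [x xB] := set0Pn _ B0.
  case: (vertex_cases x) => [[u eu]|[u [v [i [uv li ex]]]]].
    by exists u; rewrite inE -eu.
  by exists v; rewrite inE; apply: (last_in u v i); rewrite -?ex //; lia.
rewrite inE in uB'; exists (f u) => // x y xB yB /adj_branch [v uv ex].
move=> /adj_branch [v' uv' ey]; subst x y; congr pt.
by apply: u1 => //; rewrite inE; apply: (nbr_branch u).
Qed.

(** If [q] is internal, either end of its edge serves as [p]. A set [B'] avoiding [p] lifts to the
    subdivision [B] of the subgraph it induces, which avoids [q]. The vertex found in [B] is a
    branch vertex, since internal ones have two neighbours in [B]. *)
Lemma one_degenerate_of_subdivision (q : vert Hs) :
  one_degenerate [set~ q] -> exists p : vert H, one_degenerate [set~ p].
Proof.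
move=> dq.
have [p hp] : exists p, q = f p \/
    exists b i, [/\ adj p b, 0 < i <= len p b & q = pt p b i].
  case: (vertex_cases q) => [[p ->]|[p [b [i h]]]]; exists p; first by left.
  by right; exists b, i.
exists p => B' B'A B'0.
pose B := [set x | [exists u in B', (x == f u) ||
  [exists v in B', adj u v && (x \in P u v)]]].
have np u : u \in B' -> u != p by move/(subsetP B'A); rewrite !inE.
have fB u : u \in B' -> f u \in B.
  by move=> uB; rewrite inE; apply/exists_inP; exists u; rewrite ?eqxx.
have ptB u v i : u \in B' -> v \in B' -> adj u v -> i <= (len u v).+1 ->
    pt u v i \in B.
  move=> uB vB uv; case: i => [|i] li; first exact: fB.
  move: li; rewrite ltnS leq_eqVlt => /predU1P [->|li].
    by rewrite pt_last fB.
  rewrite inE; apply/exists_inP; exists u => //; apply/orP; right.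
  by apply/exists_inP; exists v => //; rewrite uv pt_mem.
have [||w] := dq B.
- apply/subsetP=> x; rewrite !inE => /exists_inP [u uB /orP [/eqP ->|]].
    case: hp => [->|[b [i [pb li ->]]]]; first by rewrite (inj_eq f_inj) np.
    by rewrite eq_sym pt_internal_neq.
  case/exists_inP=> v vB /andP [uv /mem_pt [j lj ->]].
  case: hp => [->|[b [i [pb li ->]]]]; first exact: pt_internal_neq.
  apply/eqP=> e; have [|[eu _ _]|[_ ev _]] := pt_eq uv pb lj _ e; first by lia.
    by have := np u uB; rewrite eu eqxx.
  by have := np v vB; rewrite ev eqxx.
- by have [u uB] := set0Pn _ B'0; apply/set0Pn; exists (f u); apply: fB.
rewrite inE => /exists_inP [u uB /orP [/eqP ->|]] w1.
  exists u => // v v' vB v'B uv uv'; apply: (branch_nbr_inj uv uv').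
  by apply: w1; rewrite ?ptB //; apply/adj_branch; [exists v|exists v'].
move: w1 => /exists_inP [v vB /andP [uv /mem_pt [j lj ->]]] w1; exfalso.
have : pt u v j.-1 = pt u v j.+1.
  by apply: w1; rewrite ?ptB //; try lia; apply/(adj_internal _ uv lj); [left|right].
by move/(pt_inj uv); lia.
Qed.

(** * Full star-cutsets and subdivision *)

Section SubdivisionStar.
Hypothesis tfree : triangle_free H.
Hypothesis no_cut : no_full_star_cutset H.
Hypothesis mindeg : forall v t : vert H, exists2 x, adj v x & x != t.

Let adj_out_sym (bad : {set vert Hs}) : connect_sym (adj_out bad).
Proof.
apply: sym_connect_sym => x y.
by rewrite /adj_out adj_sym [(x \notin bad) && _]andbC.
Qed.

Lemma connect_segment (bad : {set vert Hs}) u v i j : adj u v -> i <= j ->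
  j <= (len u v).+1 -> (forall k, i <= k <= j -> pt u v k \notin bad) ->
  connect (adj_out bad) (pt u v i) (pt u v j).
Proof.
move=> uv; elim: j => [|j IH] ij lj nbad.
  by have -> : i = 0 by lia.
move: ij; rewrite leq_eqVlt => /predU1P [->//|ij].
apply: (connect_trans (y := pt u v j)).
  by apply: IH => // [|k lk]; [lia|apply: nbad; lia].
by apply: connect1; rewrite /adj_out adj_pt_succ // !nbad //; lia.
Qed.

(** Here [bad] lies in the subdivided star of [a], and surviving vertices of that star reach a
    surviving end of it. From there minimum degree 2 and triangle-freeness lead to a branch vertex
    off [N[a]], and these are joined to each other because [H] has no full star-cutset at [a]. *)
Lemma connect_off_subdivided_star a (bad : {set vert Hs}) :
  (forall x, x \in bad ->
     exists t j, [/\ adj a t, j <= (len a t).+1 & x = pt a t j]) ->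
  (forall t k, adj a t -> k <= len a t -> pt a t k \notin bad ->
     exists t', [/\ adj a t', f t' \notin bad
       & connect (adj_out bad) (pt a t k) (f t')]) ->
  forall x y, x \notin bad -> y \notin bad -> connect (adj_out bad) x y.
Proof.
move=> star rest.
have far c : c \notin closed_nbhd a -> f c \notin bad.
  rewrite in_closed_nbhd negb_or => /andP [ca nac]; apply/negP=> /star.
  case=> t [[|j] [at_ lj]]; first by move/f_inj => e; rewrite e eqxx in ca.
  move: lj; rewrite ltnS leq_eqVlt => /predU1P [->|lj].
    by rewrite pt_last => /f_inj e; rewrite e at_ in nac.
  by move=> e; have := @pt_internal_neq a t j.+1 c at_; rewrite e eqxx => /(_ lj).
have inner c d k : adj c d -> c != a -> d != a -> 0 < k <= len c d ->
    pt c d k \notin bad.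
  move=> cd ca da lk; apply/negP=> /star [t [j [at_ lj e]]].
  have [[e' _ _]|[_ e' _]] := pt_eq cd at_ lk lj e.
    by rewrite e' eqxx in ca.
  by rewrite e' eqxx in da.
have off_neq c : c \notin closed_nbhd a -> c != a.
  by apply: contraNneq => ->; rewrite in_closed_nbhd eqxx.
have edge c d : adj c d -> c != a -> d != a -> f c \notin bad -> f d \notin bad ->
    forall k, k <= (len c d).+1 -> pt c d k \notin bad.
  move=> cd ca da cb db [|k] //; rewrite ltnS leq_eqVlt => /predU1P [->|lk].
    by rewrite pt_last.
  exact: inner.
have edge_conn c d : adj c d -> c != a -> d != a -> f c \notin bad ->
    f d \notin bad -> connect (adj_out bad) (f c) (f d).
  move=> cd ca da cb db; rewrite -(pt_last c d) -(pt0 c d).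
  by apply: connect_segment => // k /edge; apply.
have near c : adj a c -> f c \notin bad ->
    exists2 w, w \notin closed_nbhd a & connect (adj_out bad) (f c) (f w).
  move=> ac cb; have [t ct ta] := mindeg c a; exists t.
    rewrite in_closed_nbhd negb_or ta; apply: triangle_free_nonadj ct => //.
    by rewrite adj_sym.
  apply: edge_conn => //; first by rewrite eq_sym adj_neq.
  apply: far; rewrite in_closed_nbhd negb_or ta; apply: triangle_free_nonadj ct => //.
  by rewrite adj_sym.
have on_star t k : adj a t -> k <= len a t -> pt a t k \notin bad ->
    exists2 w, w \notin closed_nbhd a & connect (adj_out bad) (pt a t k) (f w).
  move=> at_ lk xb; have [t' [at' t'b xt']] := rest t k at_ lk xb.
  by have [w wN t'w] := near _ at' t'b; exists w => //; apply: connect_trans t'w.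
have to_far x : x \notin bad ->
    exists2 w, w \notin closed_nbhd a & connect (adj_out bad) x (f w).
  move=> xb; case: (vertex_cases x) => [[c ec]|[c [d [k [cd lk ex]]]]].
    subst x; case: (eqVneq c a) => [ca|ca].
      subst c; have [t at_ _] := mindeg a a.
      by apply: (on_star t 0).
    case: (boolP (adj a c)) => ac; first exact: near.
    by exists c; rewrite // in_closed_nbhd negb_or ca.
  subst x; case: (eqVneq c a) => [ca|ca].
    by subst c; apply: on_star => //; lia.
  case: (eqVneq d a) => [da|da].
    subst d; have ac : adj a c by rewrite adj_sym.
    rewrite (len_sym ac) in lk; move: xb.
    have -> : pt c a k = pt a c ((len a c).+1 - k) by apply: pt_sym => //; lia.
    by apply: on_star => //; lia.
  case: (boolP (adj a d)) => ad.
    have cN : c \notin closed_nbhd a.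
      rewrite in_closed_nbhd negb_or ca.
      by apply: contraL cd => ac; apply: triangle_free_nonadj ad.
    exists c => //; rewrite adj_out_sym -(pt0 c d).
    apply: connect_segment => //; first by lia.
    by case=> [_|j lj]; [apply: far|apply: inner => //; lia].
  have dN : d \notin closed_nbhd a by rewrite in_closed_nbhd negb_or da.
  exists d => //; rewrite -(pt_last c d).
  apply: connect_segment => //; first by lia.
  move=> j lj; case: (eqVneq j (len c d).+1) => [->|ne].
    by rewrite pt_last far.
  by apply: inner => //; lia.
move=> x y /to_far [w wN xw] /to_far [w' w'N yw'].
apply: (connect_trans xw); rewrite adj_out_sym; apply: (connect_trans yw').
have /connectP [c pc ->] := connect_off_star no_cut w'N wN.
elim: c (w') pc => //= d c IH t /andP [/and3P [td tN dN] pc].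
by apply: connect_trans (IH _ pc); apply: edge_conn; auto.
Qed.

(** The closed neighbourhood of [f a] consists of the positions at most 1 on the paths from [a].
    That of an internal vertex of the path of [ab] consists of three consecutive positions there,
    again within the subdivided star of [a]. *)
Lemma subdivision_no_full_star_cutset : no_full_star_cutset Hs.
Proof.
move=> z [x [y [xN yN /negP]]]; apply.
case: (vertex_cases z) => [[a ez]|[a [b [i [ab li ez]]]]]; subst z.
  have badE t j : adj a t -> j <= (len a t).+1 ->
      (pt a t j \in closed_nbhd (f a)) = (j <= 1).
    move=> at_ lj; rewrite in_closed_nbhd.
    case: j lj => [|[|j]] lj; first by rewrite eqxx.
      by rewrite (iffRL (adj_branch a _)) ?orbT //; exists t.
    apply/negP=> /orP [/eqP|/adj_branch [s as_]].
      by rewrite -(pt0 a t) => /(pt_inj at_); lia.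
    move: lj; rewrite ltnS leq_eqVlt => /predU1P [ej|lj] e; last first.
      have [||[_ _]|[e1 e2 _]] := pt_eq at_ as_ _ _ e => //.
      by rewrite e1 adj_irr in as_.
    move: e; rewrite ej pt_last => e.
    have /adj_branches [_] : adj (f a) (f t).
      by apply/adj_branch; exists s.
    by lia.
  apply: (connect_off_subdivided_star (a := a)) xN yN.
    move=> x'; rewrite in_closed_nbhd => /orP [/eqP ->|/adj_branch [t at_ ->]].
      by have [t at_ _] := mindeg a a; exists t, 0.
    by exists t, 1.
  move=> t k at_ lk; rewrite badE //; last by lia.
  rewrite -ltnNge => k1; exists t; split=> //.
    by rewrite -(pt_last a t) badE // -ltnNge; lia.
  rewrite -(pt_last a t); apply: connect_segment => //; first by lia.
  by move=> j lj; rewrite badE //; lia.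
have badP w : w \in closed_nbhd (pt a b i) ->
    exists2 j, i.-1 <= j <= i.+1 & w = pt a b j.
  rewrite in_closed_nbhd => /orP [/eqP ->|]; first by exists i => //; lia.
  by case/(adj_internal _ ab li)=> ->; [exists i.-1|exists i.+1]; rewrite //; lia.
have bad_in j : i.-1 <= j <= i.+1 -> pt a b j \in closed_nbhd (pt a b i).
  move=> lj; rewrite in_closed_nbhd; case: (eqVneq j i) => [->|ji].
    by rewrite eqxx.
  apply/orP; right; apply/(adj_internal _ ab li).
  have [->|->] : j = i.-1 \/ j = i.+1 by lia.
    by left.
  by right.
have badE j : j <= (len a b).+1 ->
    (pt a b j \in closed_nbhd (pt a b i)) = (i.-1 <= j <= i.+1).
  move=> lj; apply/idP/idP=> [/badP [k lk /(pt_inj ab)]|/bad_in //]; lia.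
have other t j : adj a t -> t != b -> 0 < j <= (len a t).+1 ->
    pt a t j \notin closed_nbhd (pt a b i).
  move=> at_ tb lj; apply/negP=> /badP [k lk e].
  have lk' : k <= (len a b).+1 by lia.
  case: (eqVneq j (len a t).+1) => [ej|nj]; last first.
    have lj' : 0 < j <= len a t by lia.
    have [[_ e' _]|[e' _ _]] := pt_eq at_ ab lj' lk' e.
      by rewrite e' eqxx in tb.
    by rewrite e' adj_irr in ab.
  move: e; rewrite ej pt_last => e; case: (posnP k) => [k0|k0].
    by move: e; rewrite k0 => /f_inj e; rewrite e adj_irr in at_.
  case: (eqVneq k (len a b).+1) => [ek|nk].
    by move: e; rewrite ek pt_last => /f_inj e; rewrite e eqxx in tb.
  have lk'' : 0 < k <= len a b by lia.
  by have := pt_internal_neq t ab lk''; rewrite -e eqxx.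
(* If [f a] survives, a neighbour of [a] other than [b] provides an undamaged path to leave by. *)
have from_a : f a \notin closed_nbhd (pt a b i) -> exists t',
    [/\ adj a t', f t' \notin closed_nbhd (pt a b i)
      & connect (adj_out (closed_nbhd (pt a b i))) (f a) (f t')].
  move=> an; have [t at_ tb] := mindeg a b; exists t; split=> //.
    by rewrite -(pt_last a t) other // ltnS leqnn.
  rewrite -(pt_last a t) -(pt0 a t); apply: connect_segment => //.
  by case=> // j lj; apply: other.
apply: (connect_off_subdivided_star (a := a)) xN yN.
  by move=> x' /badP [j lj ->]; exists b, j; split=> //; lia.
move=> t k at_ lk kN; case: (posnP k) => [k0|k0]; first by subst k; apply: from_a.
have up : (forall j, k <= j <= (len a t).+1 -> pt a t j \notin closed_nbhd (pt a b i)) ->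
    exists t', [/\ adj a t', f t' \notin closed_nbhd (pt a b i)
      & connect (adj_out (closed_nbhd (pt a b i))) (pt a t k) (f t')].
  move=> nb; exists t; split=> //; rewrite -(pt_last a t).
    by apply: nb; lia.
  by apply: connect_segment => //; lia.
case: (eqVneq t b) => [tb|tb]; last first.
  by apply: up => j lj; apply: other => //; lia.
subst t; move: kN; rewrite badE ?negb_and; last by lia.
(* Above the removed positions the path leads on to [f b]; below them it leads back to [f a] and out
   through another edge. *)
case: (leqP k i) => ki kN; last by apply: up => j lj; rewrite badE; lia.
have an : forall j, 0 <= j <= k -> pt a b j \notin closed_nbhd (pt a b i).
  by move=> j lj; rewrite badE; lia.
have [t' [at' t'N at'c]] := from_a (an 0 isT).
exists t'; split=> //; apply: connect_trans at'c.
by rewrite adj_out_sym -(pt0 a b); apply: connect_segment => //; lia.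
Qed.

End SubdivisionStar.

End Subdivision.

(** * Paths, luxury chandeliers and the equivalence *)

Lemma path_graph_leafy_apex (G : sgraph) n : 0 < n -> is_path_graph G n ->
  exists p : vert G, leafy_apex p.
Proof.
case: n => // n _ [g [[h gK hK] adjE]]; exists (h ord0).
have g_inj x y : val (g x) = val (g y) -> x = y.
  by move/val_inj/(can_inj gK).
split.
  move=> B _ /set0Pn [x0 x0B].
  (* The last vertex of [B] along the path can have only its predecessor as a neighbour in [B]. *)
  case: (arg_maxnP (fun x => val (g x)) x0B) => w wB wmax; exists w => // x y xB yB.
  have /= := wmax _ xB; have /= := wmax _ yB; rewrite !adjE => hy hx ax ay.
  apply: g_inj => /=; lia.
move=> v x y; rewrite !adjE hK /= => pv xp yp vx vy.
have gn0 z : z != h ord0 -> val (g z) != 0.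
  by apply: contraNneq => z0; rewrite -[z]gK; apply/eqP; congr h; apply: val_inj.
have /= := gn0 _ xp; have /= := gn0 _ yp => gy gx.
apply: g_inj => /=; lia.
Qed.

Lemma luxury_chandelier_leafy_apex (G : sgraph) : luxury_chandelier G ->
  exists p : vert G, leafy_apex p.
Proof.
move=> [p [[_ _ acyc] leaf _]]; exists p; split.
  exact: acyclic_one_degenerate.
move=> v x y pv xp yp vx vy; have vp : v != p by rewrite eq_sym adj_neq.
move: pv; rewrite (leaf v vp) => /cards1P [t /setP et].
have := et x; have := et y; rewrite !inE vx vy xp yp /=.
by move=> /esym/eqP -> /esym/eqP ->.
Qed.

Theorem theorem3p3 (H Hs : sgraph) :
  connected_graph H -> triangle_free H -> no_full_star_cutset H ->
  subdivision_of Hs H ->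
  (restricted_frame_graph Hs <-> (path_at_most4 H \/ luxury_chandelier H)).
Proof.
move=> conn tf nc [f [P [[f_inj P_rev] P_uniq P_disj P_cover P_adj]]].
have tfs : triangle_free Hs by apply: (@subdivision_triangle_free H Hs f P).
split=> [rfg|shape]; last first.
  have [p ap] : exists p : vert H, leafy_apex p.
    case: shape => [[n [/andP [n0 _] /path_graph_leafy_apex]]|]; first exact.
    exact: luxury_chandelier_leafy_apex.
  apply: (@leafy_apex_restricted_frame_graph _ (f p)) => //.
  exact: (@subdivision_leafy_apex H Hs f P).
case: (classic (exists w : vert H, forall x y, adj w x -> adj w y -> x = y)).
  by move=> [w w1]; left; apply: path_at_most4_of_low_degree w1.
move=> no_low; right.
have mindeg (v t : vert H) : exists2 x, adj v x & x != t.
  apply: NNPP => no_nbr; apply: no_low; exists v.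
  have eq_t x : adj v x -> x = t.
    by move=> vx; apply/eqP/negPn/negP=> xt; apply: no_nbr; exists x.
  by move=> x y /eq_t -> /eq_t ->.
have ncs : no_full_star_cutset Hs.
  exact: (@subdivision_no_full_star_cutset H Hs f P).
have Hs0 : 0 < #|vert Hs|.
  by case: conn => /card_gt0P [u _] _; apply/card_gt0P; exists (f u).
have [q dq] := restricted_frame_graph_apex Hs0 tfs ncs rfg.
have [p dp] : exists p : vert H, one_degenerate [set~ p].
  exact: (@one_degenerate_of_subdivision H Hs f P f_inj P_rev P_uniq P_disj P_cover P_adj q).
exact: luxury_chandelier_of_apex dp.
Qed.
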